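(* Let $G$ be a simply connected $2n$-dimensional Lie group equipped with a left invariant complex structure $J$, let $\Gamma\subset G$ be a uniform lattice, and equip $\Gamma\backslash G$ with the induced complex structure $J$. If $\sigma$ is a nonzero invariant $(n,0)$-form on $\Gamma\backslash G$ and $f:\Gamma\backslash G\to\mathbb{C}^\times$ is a smooth function such that $\tau:=f\sigma$ is closed, then $f$ is unique up to a nonzero constant (i.e. any other smooth $f':\Gamma\backslash G\to\mathbb{C}^\times$ with $f'\sigma$ closed is of the form $f'=cf$ with $c\in\mathbb{C}^\times$). In particular, nowhere vanishing closed $(n,0)$-forms on $(\Gamma\backslash G,J)$ are either all invariant or all non-invariant.
   Context: Simply connected Lie groups are understood to be connected. $\mathbb{C}^\times=\mathbb{C}\setminus\{0\}$. A left invariant complex structure on $G$ is one for which left translations are holomorphic. A uniform lattice is a discrete subgroup $\Gamma$ with $\Gamma\backslash G$ compact. A differential form on $\Gamma\backslash G$ is called invariant if it is induced by a left invariant form on $G$. *)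

(* Defs.v *)
From HB Require Import structures.
From mathcomp Require Import all_boot all_order all_algebra generic_quotient.
From mathcomp Require Import all_classical all_reals all_analysis.
From mathcomp Require Import complex.

Set Implicit Arguments.
Unset Strict Implicit.
Unset Printing Implicit Defensive.

Import Order.TTheory GRing.Theory Num.Theory.
Import numFieldNormedType.Exports.

Local Open Scope classical_set_scope.
Local Open Scope ring_scope.
Local Open Scope complex_scope.
Local Open Scope quotient_scope.

(** * Smooth functions between open sets of normed spaces *)

(* Meaningful for U open. *)
Fixpoint Ck_on (R : realType) (V W : normedModType R) (k : nat)
    (U : set V) (f : V -> W) : Prop :=
  match k with
  | 0 => forall x, U x -> {for x, continuous f}
  | k'.+1 => (forall x, U x -> differentiable f x) /\
             (forall v : V, Ck_on k' U ('D_v f))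
  end.

Definition smooth_on (R : realType) (V W : normedModType R)
    (U : set V) (f : V -> W) : Prop := forall k, Ck_on k U f.

(** * Smooth manifolds *)

(* A homeomorphism between an open set of M and an open set of R^m.  The values
   of cmap outside cdom and of cinv outside cimg are irrelevant. *)
Record chart (R : realType) (m : nat) (M : topologicalType) := Chart {
  cdom : set M;
  cimg : set 'rV[R]_m;
  cmap : M -> 'rV[R]_m;
  cinv : 'rV[R]_m -> M;
  cdom_open : open cdom;
  cimg_open : open cimg;
  cmap_img : forall p, cdom p -> cimg (cmap p);
  cinv_dom : forall x, cimg x -> cdom (cinv x);
  cmapK : forall p, cdom p -> cinv (cmap p) = p;
  cinvK : forall x, cimg x -> cmap (cinv x) = x;
  cmap_continuous : forall p, cdom p -> {for p, continuous cmap};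
  cinv_continuous : forall x, cimg x -> {for x, continuous cinv} }.

(* The domain of the change of coordinates from phi to psi, inside R^m. *)
Definition overlap (R : realType) (m : nat) (M : topologicalType)
    (phi psi : chart R m M) : set 'rV[R]_m :=
  [set x | cimg phi x /\ cdom psi (cinv phi x)].

(* The atlas {chart_at p | p in M} comes with a preferred chart around each
   point.  The tangent space T_p M is R^m, a vector being represented by its
   coordinates in the chart chart_at p. *)
Record manifold (R : realType) (m : nat) (M : topologicalType) := Manifold {
  chart_at : M -> chart R m M;
  mem_chart_at : forall p, cdom (chart_at p) p;
  chart_at_compat : forall p q,
    smooth_on (overlap (chart_at p) (chart_at q))
              (cmap (chart_at q) \o cinv (chart_at p));
  manifold_hausdorff : hausdorff_space M;
  manifold_second_countable : @second_countable M }.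

(* The charts of the maximal atlas. *)
Definition smooth_chart (R : realType) (m : nat) (M : topologicalType)
    (D : manifold R m M) (phi : chart R m M) : Prop :=
  forall p,
    smooth_on (overlap (chart_at D p) phi) (cmap phi \o cinv (chart_at D p)) /\
    smooth_on (overlap phi (chart_at D p)) (cmap (chart_at D p) \o cinv phi).

(* Meaningful for A open. *)
Definition smooth_map_on (R : realType) (m1 m2 : nat) (M N : topologicalType)
    (DM : manifold R m1 M) (DN : manifold R m2 N)
    (A : set M) (F : M -> N) : Prop :=
  (forall p, A p -> {for p, continuous F}) /\
  (forall p q,
    smooth_on [set x | [/\ cimg (chart_at DM p) x, A (cinv (chart_at DM p) x) &
                           cdom (chart_at DN q) (F (cinv (chart_at DM p) x))]]
              (cmap (chart_at DN q) \o F \o cinv (chart_at DM p))).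

Definition smooth_map (R : realType) (m1 m2 : nat) (M N : topologicalType)
    (DM : manifold R m1 M) (DN : manifold R m2 N) (F : M -> N) : Prop :=
  smooth_map_on DM DN setT F.

(* Smoothness of F : M1 x M2 -> N for the product manifold structure. *)
Definition smooth_map2 (R : realType) (m1 m2 m : nat)
    (M1 M2 N : topologicalType) (D1 : manifold R m1 M1)
    (D2 : manifold R m2 M2) (DN : manifold R m N) (F : M1 * M2 -> N) : Prop :=
  continuous F /\
  (forall p q r,
    let F_loc (z : 'rV[R]_m1 * 'rV[R]_m2) :=
      F (cinv (chart_at D1 p) z.1, cinv (chart_at D2 q) z.2) in
    smooth_on [set z | [/\ cimg (chart_at D1 p) z.1,
                           cimg (chart_at D2 q) z.2 &
                           cdom (chart_at DN r) (F_loc z)]]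
              (cmap (chart_at DN r) \o F_loc)).

(* Matrices of differentials act on row vectors: dF_p(v) = v *m tangent F p. *)
Definition tangent (R : realType) (m1 m2 : nat) (M N : topologicalType)
    (DM : manifold R m1 M) (DN : manifold R m2 N) (F : M -> N) (p : M) :
    'M[R]_(m1, m2) :=
  'J (cmap (chart_at DN (F p)) \o F \o cinv (chart_at DM p))
     (cmap (chart_at DM p) p).

(* The differential at q of the coordinates phi, from T_q M to R^m. *)
Definition chart_tangent (R : realType) (m : nat) (M : topologicalType)
    (D : manifold R m M) (phi : chart R m M) (q : M) : 'M[R]_m :=
  'J (cmap phi \o cinv (chart_at D q)) (cmap (chart_at D q) q).

(* The differential at x of the parametrization phi^-1, into T_(phi^-1 x) M. *)
Definition param_tangent (R : realType) (m : nat) (M : topologicalType)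
    (D : manifold R m M) (phi : chart R m M) (x : 'rV[R]_m) : 'M[R]_m :=
  'J (cmap (chart_at D (cinv phi x)) \o cinv phi) x.

Definition local_diffeo (R : realType) (m : nat) (M N : topologicalType)
    (DM : manifold R m M) (DN : manifold R m N) (F : M -> N) : Prop :=
  smooth_map DM DN F /\
  forall p, exists (A : set M) (H : N -> M),
    [/\ open A, A p, open (F @` A), forall q, A q -> H (F q) = q &
        smooth_map_on DN DM (F @` A) H].

(** * Complex-valued functions and differential forms *)

Definition smooth_on_C (R : realType) (V : normedModType R)
    (U : set V) (f : V -> R[i]) : Prop :=
  smooth_on U (fun x => complex.Re (f x) : R) /\
  smooth_on U (fun x => complex.Im (f x) : R).

Definition derive_C (R : realType) (V : normedModType R)
    (f : V -> R[i]) (v x : V) : R[i] :=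
  'D_v (fun y => complex.Re (f y) : R) x +i*
  'D_v (fun y => complex.Im (f y) : R) x.

Definition smooth_fun_C (R : realType) (m : nat) (M : topologicalType)
    (D : manifold R m M) (f : M -> R[i]) : Prop :=
  forall p, smooth_on_C (cimg (chart_at D p)) (f \o cinv (chart_at D p)).

(* A field of functions of k tangent vectors.  The k vectors are the rows of
   a k x m matrix. *)
Definition preform (R : realType) (k m : nat) (M : Type) :=
  M -> 'M[R]_(k, m) -> R[i].

(* Stated as determinant_multilinear and determinant_alternate are. *)
Definition alternating_multilinear (R : realType) (k m : nat)
    (w : 'M[R]_(k, m) -> R[i]) : Prop :=
  (forall (A B C : 'M[R]_(k, m)) (i0 : 'I_k) (b c : R),
     row i0 A = b *: row i0 B + c *: row i0 C ->
     row' i0 B = row' i0 A -> row' i0 C = row' i0 A ->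
     w A = b%:C * w B + c%:C * w C) /\
  (forall (A : 'M[R]_(k, m)) (i1 i2 : 'I_k),
     i1 != i2 -> row i1 A = row i2 A -> w A = 0).

(* The expression of w in the coordinates phi: the pullback of w by phi^-1. *)
Definition form_in (R : realType) (k m : nat) (M : topologicalType)
    (D : manifold R m M) (phi : chart R m M) (w : preform R k m M) :
    preform R k m 'rV[R]_m :=
  fun x A => w (cinv phi x) (A *m param_tangent D phi x).

(* Smooth complex-valued k-forms. *)
Definition is_form (R : realType) (k m : nat) (M : topologicalType)
    (D : manifold R m M) (w : preform R k m M) : Prop :=
  (forall p, alternating_multilinear (w p)) /\
  (forall p (A : 'M[R]_(k, m)),
     smooth_on_C (cimg (chart_at D p)) (form_in D (chart_at D p) w ^~ A)).

(* d w (v_0, ..., v_k)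
     = \sum_i (-1)^i D_(v_i) (w (v_0, ..., v_(i-1), v_(i+1), ..., v_k))
   for constant vectors v_i of R^m. *)
Definition ext_deriv_coord (R : realType) (k m : nat)
    (w : preform R k m 'rV[R]_m) : preform R k.+1 m 'rV[R]_m :=
  fun x A =>
    \sum_(i < k.+1) (-1) ^+ i * derive_C (fun y => w y (row' i A)) (row i A) x.

(* T_p M is identified with R^m by chart_at p, so d w at p is the value of the
   coordinate formula in that chart. *)
Definition ext_deriv (R : realType) (k m : nat) (M : topologicalType)
    (D : manifold R m M) (w : preform R k m M) : preform R k.+1 m M :=
  fun p =>
    ext_deriv_coord (form_in D (chart_at D p) w) (cmap (chart_at D p) p).

Definition closed_form (R : realType) (k m : nat) (M : topologicalType)
    (D : manifold R m M) (w : preform R k m M) : Prop :=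
  forall p A, ext_deriv D w p A = 0.

Definition pullback (R : realType) (k m1 m2 : nat) (M N : topologicalType)
    (DM : manifold R m1 M) (DN : manifold R m2 N) (F : M -> N)
    (w : preform R k m2 N) : preform R k m1 M :=
  fun p A => w (F p) (A *m tangent DM DN F p).

Definition scale_form (R : realType) (k m : nat) (M : topologicalType)
    (f : M -> R[i]) (w : preform R k m M) : preform R k m M :=
  fun p A => f p * w p A.

Definition nonzero_form (R : realType) (k m : nat) (M : topologicalType)
    (w : preform R k m M) : Prop := exists p A, w p A != 0.

Definition nowhere_vanishing (R : realType) (k m : nat) (M : topologicalType)
    (w : preform R k m M) : Prop := forall p, exists A, w p A != 0.

(** * Complex structures *)

(* Multiplication by i on C^n = R^n x R^n, z = x + i y being the row (x, y):
   (x, y) *m std_J n = (- y, x). *)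
Definition std_J (R : realType) (n : nat) : 'M[R]_(n + n) :=
  block_mx 0 1%:M (- 1%:M) 0.

(* An almost complex structure (J_p v = v *m J p) which is integrable: every
   point has smooth coordinates with values in C^n in which it is the
   multiplication by i. *)
Record complex_structure (R : realType) (n : nat) (M : topologicalType)
    (D : manifold R (n + n) M) := ComplexStructure {
  cs_J :> M -> 'M[R]_(n + n);
  cs_sqr : forall p, cs_J p *m cs_J p = - 1%:M;
  cs_integrable : forall p, exists phi : chart R (n + n) M,
    [/\ smooth_chart D phi, cdom phi p &
        forall q, cdom phi q ->
          cs_J q *m chart_tangent D phi q
          = chart_tangent D phi q *m std_J R n] }.

Definition holomorphic (R : realType) (n1 n2 : nat) (M N : topologicalType)
    (DM : manifold R (n1 + n1) M) (DN : manifold R (n2 + n2) N)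
    (JM : complex_structure DM) (JN : complex_structure DN)
    (F : M -> N) : Prop :=
  smooth_map DM DN F /\
  forall p, JM p *m tangent DM DN F p = tangent DM DN F p *m JN (F p).

(* w is of type (k,0) when its C-multilinear extension vanishes as soon as one
   argument is of type (0,1), i.e. of the form v + i J v, which reads
   w(.., v, ..) + i w(.., J v, ..) = 0. *)
Definition is_k0_form (R : realType) (k n : nat) (M : topologicalType)
    (D : manifold R (n + n) M) (J : complex_structure D)
    (w : preform R k (n + n) M) : Prop :=
  is_form D w /\
  forall p (A B : 'M[R]_(k, n + n)) (i0 : 'I_k),
    row i0 B = row i0 A *m J p -> row' i0 B = row' i0 A ->
    w p A + 'i%C * w p B = 0.

(** * Lie groups and their quotients by discrete subgroups *)

#[short(type="groupTopType")]
HB.structure Definition GroupTop := {G of Group G & Topological G}.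

Record lie_group (R : realType) (m : nat) (G : groupTopType) := LieGroup {
  lie_manifold :> manifold R m G;
  lie_mul_smooth : smooth_map2 lie_manifold lie_manifold lie_manifold
                     (fun xy : G * G => (xy.1 * xy.2)%g);
  lie_inv_smooth : smooth_map lie_manifold lie_manifold
                     (fun x : G => (x^-1)%g) }.

Definition ltrans (G : groupTopType) (g : G) : G -> G := fun x => (g * x)%g.

Definition left_invariant_cs (R : realType) (n : nat) (G : groupTopType)
    (D : lie_group R (n + n) G) (J : complex_structure D) : Prop :=
  forall g, holomorphic J J (ltrans g).

Definition left_invariant_form (R : realType) (k m : nat) (G : groupTopType)
    (D : lie_group R m G) (w : preform R k m G) : Prop :=
  is_form D w /\ forall g, pullback D D (ltrans g) w = w.

(* Path-connected, with trivial fundamental group at every base point. *)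
Definition simply_connected (R : realType) (T : topologicalType) : Prop :=
  (forall x y : T, exists c : R -> T,
     [/\ {within `[0, 1], continuous c}, c 0 = x & c 1 = y]) /\
  (forall c : R -> T, {within `[0, 1], continuous c} -> c 0 = c 1 ->
     exists H : R * R -> T,
       [/\ {within `[0, 1] `*` `[0, 1], continuous H},
           forall t, `[0, 1]%classic t -> H (0, t) = c t /\ H (1, t) = c 0 &
           forall s, `[0, 1]%classic s -> H (s, 0) = c 0 /\ H (s, 1) = c 0]).

Definition discrete_subgroup (G : groupTopType) (Gamma : groupClosed G) :
    Prop :=
  forall g, g \in Gamma -> exists U : set G,
    open U /\ U `&` [set x | x \in Gamma] = [set g].

(* Gamma x = Gamma y *)
Definition orbit_rel (G : groupTopType) (Gamma : groupClosed G) (x y : G) :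
    bool := (x / y)%g \in Gamma.

Lemma orbit_rel_equiv (G : groupTopType) (Gamma : groupClosed G) :
  equiv_class_of (orbit_rel Gamma).
Proof.
split=> [x|x y|y x z]; rewrite /orbit_rel.
- by rewrite divgg gpred1.
- by rewrite gpredFC.
- by move=> xy yz; rewrite -(divgKA y x z^-1%g) gpredM.
Qed.

Definition orbit_equiv (G : groupTopType) (Gamma : groupClosed G) :
    equiv_rel G := EquivRelPack (orbit_rel_equiv Gamma).

(* Gamma \ G with the quotient topology *)
Definition lquot (G : groupTopType) (Gamma : groupClosed G) : Type :=
  quotient_topology {eq_quot orbit_equiv Gamma}.

HB.instance Definition _ (G : groupTopType) (Gamma : groupClosed G) :=
  Topological.copy (lquot Gamma)
    (quotient_topology {eq_quot orbit_equiv Gamma}).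

Definition lproj (G : groupTopType) (Gamma : groupClosed G) (x : G) :
    lquot Gamma := \pi_(quotient_topology {eq_quot orbit_equiv Gamma}) x.

Definition uniform_lattice (G : groupTopType) (Gamma : groupClosed G) : Prop :=
  discrete_subgroup Gamma /\ compact [set: lquot Gamma].

(* Forms on Gamma \ G induced by a left invariant form on G. *)
Definition invariant_form (R : realType) (k m : nat) (G : groupTopType)
    (Gamma : groupClosed G) (D : lie_group R m G)
    (DQ : manifold R m (lquot Gamma)) (w : preform R k m (lquot Gamma)) :
    Prop :=
  is_form DQ w /\
  exists a : preform R k m G,
    left_invariant_form D a /\ pullback D DQ (@lproj G Gamma) w = a.

(* Main.v *)
(* The quotient h = f' / f satisfies dh /\ tau = 0 with tau = f sigma a nowhere
   vanishing (n,0)-form, so that dh is of type (1,0), i.e. h is holomorphic; on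
   the compact connected manifold Gamma \ G it is constant by the maximum
   principle.  For the dichotomy, (n,0)-forms are multiples of each other at
   every point, so if tau_0 is closed, nowhere vanishing and invariant, any
   closed nowhere vanishing tau is f tau_0 with f smooth, and f is constant by
   the first part (with sigma = tau_0 and f = 1).

   The strong maximum principle is obtained without integration: if u = Re h is
   maximal at x but not on the whole circle |z| = 1 of a complex line x + z v,
   finitely many rotations of that line suffice for the sum of the rotated
   functions to be smaller on the circle than at the centre, which contradicts
   the weak maximum principle. *)
Require Import Defs.
From HB Require Import structures.
From mathcomp Require Import all_boot all_order all_algebra.
From mathcomp Require Import all_classical all_reals all_analysis.
From mathcomp Require Import complex.
From mathcomp Require Import perm ring lra.

Import Order.TTheory GRing.Theory Num.Theory.
Import numFieldNormedType.Exports.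

Local Open Scope classical_set_scope.
Local Open Scope ring_scope.
Local Open Scope complex_scope.

Set Implicit Arguments.
Unset Strict Implicit.
Unset Printing Implicit Defensive.

(** * Second derivatives *)

(** All that is kept of the holomorphy of h = u + i w is the pair of real equations D_(J v) u = -
    D_v w and D_(J v) w = D_v u. In a chart given by integrability J is a constant linear map, so
    these equations make u harmonic on every affine complex line, provided that mixed second
    derivatives commute; hence the symmetry of second derivatives is the analytic input. Multiplying
    v by a unit complex number c + i d turns the pair (v, J v) into (c v + d J v, c J v - d v),
    which is again of the form (z, J z). Harmonicity therefore passes to each rotated function and
    to finite sums of them, and compactness of the circle takes over the role of averaging over all
    rotations. The weak maximum principle for such a sum comes from adding a small multiple of
    |z|^2, which makes the Laplacian positive at an interior maximum. Only real parts are ever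
    maximised; Im h is reached as the real part of - i h. *)

Lemma is_derive_line (R : realType) (V W : normedModType R) (f : V -> W)
    (x v : V) (s : R) :
  derivable f (s *: v + x) v ->
  is_derive s (1 : R) (fun t : R => f (t *: v + x)) ('D_v f (s *: v + x)).
Proof.
have E : (fun h : R => h^-1 *: (((fun t : R => f (t *: v + x)) \o shift s)
            (h *: (1 : R)) - f (s *: v + x)))
       = (fun h : R => h^-1 *: ((f \o shift (s *: v + x)) (h *: v)
            - f (s *: v + x))).
  apply/funext => h; congr (_ *: (f _ - _)).
  by rewrite /= /shift /= [h *: 1]mulr1 scalerDl addrA.
by move=> dfv; split; rewrite /derivable /derive E.
Qed.

(** At the maximum [df s = 0]. If [d] were positive, [df] would be positive just to the right of
    [s], and the mean value theorem would make [f] exceed [f s] there. *)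
Lemma second_derivative_test (R : realType) (f df : R -> R) (s e d : R) :
  0 < e -> (forall t, `|t - s| < e -> is_derive t 1 f (df t)) ->
  is_derive s 1 df d -> (forall t, `|t - s| < e -> f t <= f s) -> d <= 0.
Proof.
move=> e0 fdf dfd smax; rewrite leNgt; apply/negP => d0.
have itve t : t \in `]s - e, s + e[ -> `|t - s| < e.
  by rewrite in_itv /= => /andP[a b]; rewrite ltr_norml; lra.
have dfs0 : df s = 0.
  have sin : s \in `]s - e, s + e[ by rewrite in_itv /=; lra.
  have /@derive_val : is_derive s 1 f 0.
    apply: (@derive1_at_max _ _ (s - e) (s + e)) => //; first lra.
      by move=> t /itve /fdf [].
    by move=> t /itve; exact: smax.
  by case: (fdf s); rewrite ?subrr ?normr0 // => _ ->.
have [/cvg_ex[l lP] dl] := dfd.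
have {l lP dl} : (fun h => h^-1 *: ((df \o shift s) (h *: 1) - df s)) h
            @[h --> 0^'] --> d.
  by rewrite -dl /derive; apply/cvg_ex; exists l.
(* The tolerance is [d] itself, so the difference quotients of [df] stay strictly positive. *)
move=> /cvgrPdist_lt /(_ _ d0); rewrite near_withinE => /nbhs_ballP[r /= r0 rP].
pose t := Num.min r e / 2.
have t0 : 0 < t by rewrite divr_gt0 // lt_min r0 e0.
have tr : t < r by rewrite /t ltr_pdivrMr // gt_min; apply/orP; left; lra.
have te : t < e by rewrite /t ltr_pdivrMr // gt_min; apply/orP; right; lra.
have dfpos h : 0 < h -> h <= t -> 0 < df (s + h).
  move=> h0 ht; have := rP h; rewrite /ball /= sub0r normrN gtr0_norm //.
  move=> /(_ (le_lt_trans ht tr) (lt0r_neq0 h0)).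
  rewrite dfs0 subr0 /shift /= [h *: 1]mulr1 [h + s]addrC ltr_norml => /andP[_].
  rewrite -subr_gt0 opprB addrCA subrr addr0 => H.
  by rewrite -(pmulr_rgt0 _ (_ : 0 < h^-1)) // invr_gt0.
have sst : s < s + t by lra.
have [||c] := @MVT _ f df s (s + t) sst.
- move=> x; rewrite in_itv /= => /andP[a b]; apply: fdf.
  by rewrite ltr_norml; lra.
- apply: derivable_within_continuous => x; rewrite in_itv /= => /andP[a b].
  by case: (fdf x) => //; rewrite ltr_norml; lra.
rewrite in_itv /= => /andP[a b] fE.
have := smax (s + t); rewrite addrC addKr gtr0_norm // => /(_ te).
have : 0 < df c * (s + t - s).
  apply: mulr_gt0; last lra.
  by have := dfpos (c - s); rewrite subrKC; apply; lra.
by rewrite -fE [s + t]addrC; lra.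
Qed.

Lemma MVT_closed (R : realType) (f df : R -> R) (b : R) : 0 < b ->
  (forall t, 0 <= t <= b -> is_derive t 1 f (df t)) ->
  exists2 c, 0 <= c <= b & f b - f 0 = df c * b.
Proof.
move=> b0 fdf; have [||c cb fE] := @MVT _ f df 0 b b0.
- move=> x; rewrite in_itv /= => /andP[x0 xb]; apply: fdf.
  by rewrite !ltW.
- apply: derivable_within_continuous => x; rewrite in_itv /= => xb.
  by case: (fdf x).
exists c; last by rewrite fE subr0.
by move: cb; rewrite in_itv /= => /andP[? ?]; rewrite !ltW.
Qed.

(** Two applications of the mean value theorem: along [v] to the difference of [f] over two opposite
    sides of the parallelogram, then along [w] to ['D_v f]. The left-hand side is symmetric in [v]
    and [w], which is what makes it useful. *)
Lemma second_difference (R : realType) (V : normedModType R) (U : set V)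
    (f : V -> R) (x v w : V) (h : R) : 0 < h ->
  (forall s t, 0 <= s <= h -> 0 <= t <= h -> U (t *: w + (s *: v + x))) ->
  (forall y, U y -> derivable f y v) ->
  (forall y, U y -> derivable ('D_v f) y w) ->
  exists s t, [/\ 0 <= s <= h, 0 <= t <= h &
    f (h *: w + (h *: v + x)) - f (h *: v + x) - (f (h *: w + x) - f x) =
    'D_w ('D_v f) (t *: w + (s *: v + x)) * h * h].
Proof.
move=> h0 hU df ddf.
have hh : 0 <= h <= h by rewrite (ltW h0) lexx.
have h00 : 0 <= (0 : R) <= h by rewrite lexx (ltW h0).
have [s sh sE] := @MVT_closed _
  (fun s => f (s *: v + (h *: w + x)) - f (s *: v + x))
  (fun s => 'D_v f (s *: v + (h *: w + x)) - 'D_v f (s *: v + x)) h h0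
  ltac:(move=> s sh; apply: is_deriveB; apply: is_derive_line; apply: df;
    [rewrite addrCA; exact: hU|have := hU s 0 sh h00; by rewrite scale0r add0r]).
have [t th tE] := @MVT_closed _ (fun t => 'D_v f (t *: w + (s *: v + x)))
  (fun t => 'D_w ('D_v f) (t *: w + (s *: v + x))) h h0
  ltac:(move=> t th; apply: is_derive_line; apply: ddf; exact: hU).
exists s, t; split => //; rewrite -tE scale0r add0r.
rewrite (addrCA (h *: w) (s *: v)) -sE !scale0r !add0r.
rewrite (addrCA (h *: w) (h *: v)); ring.
Qed.

Lemma small_square (R : realType) (V : normedModType R) (x v w : V) (P : set V) :
  nbhs x P -> exists2 h : R, 0 < h &
    forall s t, `|s| <= h -> `|t| <= h -> P (t *: w + (s *: v + x)).
Proof.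
move=> /nbhs_ballP[e /= e0 eP].
have n0 : 0 < `|v| + `|w| + 1 by rewrite ltr_pwDr // addr_ge0.
exists (e / 2 / (`|v| + `|w| + 1)); first by rewrite !divr_gt0.
move=> s t sh th; apply: eP; rewrite -ball_normE /ball_ /=.
rewrite addrA opprD addrCA subrr addr0 normrN.
apply: le_lt_trans (ler_normD _ _) _; rewrite !normrZ.
move: sh th; rewrite !ler_pdivlMr // => sh th.
have := normr_ge0 v; have := normr_ge0 w; have := normr_ge0 s; have := normr_ge0 t.
nra.
Qed.

Lemma Ck_on1 (R : realType) (V W : normedModType R) (k : nat) (U : set V)
    (f : V -> W) : Ck_on k.+1 U f -> Ck_on k U f.
Proof.
elim: k f => [|k IH] f [df ddf] /=.
  by move=> x /df /differentiable_continuous.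
by split=> // v; exact: IH.
Qed.

(** Both orders of differentiation compute the same second difference, so the two mixed derivatives
    agree at some pair of points of an arbitrarily small square at [x]. Were their values at [x] a
    distance [d] apart, continuity would keep each within [d / 2] of its value at [x], which
    excludes a common value. *)
Lemma derive_comm (R : realType) (V : normedModType R) (U : set V)
    (f : V -> R) (x v w : V) : open U -> Ck_on 2 U f -> U x ->
  'D_w ('D_v f) x = 'D_v ('D_w f) x.
Proof.
move=> oU [df ddf] Ux.
have der y z : U y -> derivable f y z by move=> /df; exact: diff_derivable.
have dder y z z' : U y -> derivable ('D_z f) y z'.
  by move=> /(proj1 (ddf z)); exact: diff_derivable.
have C z z' : {for x, continuous ('D_z' ('D_z f))} by exact: (proj2 (ddf z) z').
have T (a b c : R) : `|a - c| < `|a - b| / 2 -> `|b - c| < `|a - b| / 2 -> False.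
  by have := ler_distD c a b; rewrite (distrC c b); lra.
apply/eqP; rewrite -subr_eq0 -normr_eq0; apply/negPn/negP => ne.
set d := `|_| in ne; have d0 : 0 < d / 2.
  by rewrite divr_gt0 // lt_def ne /d normr_ge0.
have /cvgrPdist_lt /(_ _ d0) N1 := C v w.
have /cvgrPdist_lt /(_ _ d0) N2 := C w v.
have [h h0 hP] := small_square v w (filterI (open_nbhs_nbhs (conj oU Ux)) (filterI N1 N2)).
have le_norm s : 0 <= s <= h -> `|s| <= h by move=> /andP[? ?]; rewrite ger0_norm.
have [|||s [t [sh th E1]]] := @second_difference _ _ U f x v w h h0.
- by move=> s t /le_norm sh /le_norm th; case: (hP s t sh th).
- by move=> y; exact: der.
- by move=> y; exact: dder.
have [|||t' [s' [th' sh' E2]]] := @second_difference _ _ U f x w v h h0.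
- by move=> a b /le_norm ah /le_norm bh; rewrite addrCA; case: (hP b a bh ah).
- by move=> y; exact: der.
- by move=> y; exact: dder.
have E : 'D_w ('D_v f) (t *: w + (s *: v + x)) =
         'D_v ('D_w f) (s' *: v + (t' *: w + x)).
  apply: (mulIf (lt0r_neq0 h0)); apply: (mulIf (lt0r_neq0 h0)).
  apply: (etrans (esym E1)); apply: etrans E2.
  rewrite (addrCA (h *: v) (h *: w)); ring.
have [_ [P1 _]] := hP s t (le_norm _ sh) (le_norm _ th).
have [_ [_ ]] := hP s' t' (le_norm _ sh') (le_norm _ th').
rewrite addrCA -E => P2.
exact: T P1 P2.
Qed.

(** * The maximum principle *)

Lemma is_derive_seq_sum (R : realType) (I : eqType) (l : seq I)
    (f : I -> R -> R) (df : I -> R) (s : R) :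
  {in l, forall i, is_derive s 1 (f i) (df i)} ->
  is_derive s 1 (fun t => \sum_(i <- l) f i t) (\sum_(i <- l) df i).
Proof.
elim: l => [|i l IH] fdf.
  rewrite big_nil (_ : (fun _ => _) = cst 0); first exact: is_derive_cst.
  by apply/funext => t; rewrite big_nil.
rewrite big_cons (_ : (fun _ => _) = f i + (fun t => \sum_(j <- l) f j t)).
  apply: is_deriveD; first by apply: fdf; exact: mem_head.
  by apply: IH => j jl; apply: fdf; rewrite in_cons jl orbT.
by apply/funext => t; rewrite big_cons.
Qed.

Lemma continuous_seq_sum (R : realType) (W : normedModType R)
    (T : topologicalType) (I : eqType) (l : seq I) (f : I -> T -> W) (p : T) :
  {in l, forall i, {for p, continuous (f i)}} ->
  {for p, continuous (fun q => \sum_(i <- l) f i q)}.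
Proof.
elim: l => [|i l IH] cf.
  rewrite (_ : (fun _ => _) = cst 0); first exact: cst_continuous.
  by apply/funext => t; rewrite big_nil.
rewrite (_ : (fun _ => _) = (fun q => f i q + \sum_(j <- l) f j q)).
  apply: continuousD; first by apply: cf; exact: mem_head.
  by apply: IH => j jl; apply: cf; rewrite in_cons jl orbT.
by apply/funext => t; rewrite big_cons.
Qed.

Definition sqnorm2 (R : realType) (p : R * R) : R := p.1 ^+ 2 + p.2 ^+ 2.

Lemma sqnorm2_continuous (R : realType) : continuous (@sqnorm2 R).
Proof.
move=> p; apply: (@continuousD _ _ _ (fun p : R * R => p.1 ^+ 2) (fun p => p.2 ^+ 2)).
  apply: (@continuous_comp _ _ _ fst (fun x : R => x ^+ 2)); first exact: cvg_fst.
  exact: exprn_continuous.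
apply: (@continuous_comp _ _ _ snd (fun x : R => x ^+ 2)); first exact: cvg_snd.
exact: exprn_continuous.
Qed.

Lemma sqnorm2_le1_bound (R : realType) (p : R * R) :
  sqnorm2 p <= 1 -> `|p.1| <= 1 /\ `|p.2| <= 1.
Proof.
rewrite /sqnorm2 !ler_norml => h.
by split; apply/andP; split; nra.
Qed.

Lemma compact_sub_disc (R : realType) (A : set R) : closed A ->
  A `<=` [set r | r <= 1] -> compact [set p : R * R | A (sqnorm2 p)].
Proof.
pose I := `[(-1 : R), 1]%classic.
move=> cA A1; apply: (@subclosed_compact _ _ (I `*` I)).
- apply: (@preimage_closed _ _ (@sqnorm2 R)) => // p _; exact: sqnorm2_continuous.
- by apply: compact_setX; exact: segment_compact.
- move=> p /A1 /= /sqnorm2_le1_bound [].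
  by rewrite !ler_norml => h1 h2; split; rewrite /I /= in_itv /=.
Qed.

Lemma sum_second_derivative_le0 (R : realType) (V : normedModType R) (U : set V)
    (u : V -> R) (I : eqType) (l : seq I) (a y : I -> V) (M k eps s0 e : R) :
  Ck_on 2 U u -> 0 < e ->
  (forall s, `|s - s0| < e -> {in l, forall i, U (s *: a i + y i)}) ->
  (forall s, `|s - s0| < e ->
    \sum_(i <- l) (u (s *: a i + y i) - M) + eps * (s ^+ 2 + k) <=
    \sum_(i <- l) (u (s0 *: a i + y i) - M) + eps * (s0 ^+ 2 + k)) ->
  \sum_(i <- l) 'D_(a i) ('D_(a i) u) (s0 *: a i + y i) + eps * 2 <= 0.
Proof.
move=> [du ddu] e0 lU smax.
pose df (s : R) : R := \sum_(i <- l) 'D_(a i) u (s *: a i + y i) + eps * (2 * s).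
apply: (@second_derivative_test _ _ df s0 e _ e0 _ _ smax).
  move=> s se; apply: is_deriveD.
    apply: is_derive_seq_sum => i il.
    rewrite -[X in is_derive _ _ _ X]subr0; apply: is_deriveB.
    by apply: is_derive_line; apply/diff_derivable/du; exact: lU.
  apply: is_deriveZ; rewrite -[X in is_derive _ _ _ X]addr0; apply: is_deriveD.
  by apply: is_derive_eq; rewrite /= /GRing.scale /=; ring.
have H1 : is_derive s0 1 (fun s => \sum_(i <- l) 'D_(a i) u (s *: a i + y i))
   (\sum_(i <- l) 'D_(a i) ('D_(a i) u) (s0 *: a i + y i)).
  apply: is_derive_seq_sum => i il; apply: is_derive_line; apply/diff_derivable.
  by apply: (proj1 (ddu _)); apply: lU => //; rewrite subrr normr0.
have H2 : is_derive s0 1 (fun s : R => eps * (2 * s)) (eps * 2).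
  apply: is_deriveZ; rewrite -[X in is_derive _ _ _ X]mulr1; exact: is_deriveZ.
exact: (is_deriveD H1 H2).
Qed.

HB.instance Definition _ (R : realType) := Pointed.on (R * R)%type.

Lemma compact_cover_prod (R : realType) (C : set (R * R)) :
  compact C -> cover_compact C.
Proof. by rewrite (compact_cover (R * R)%type). Qed.

(** * The strong maximum principle on one complex line *)

Section Disc.
Variables (R : realType) (V : normedModType R) (U : set V) (u : V -> R).
Variables (x v v' : V) (M : R).
Hypothesis u2 : Ck_on 2 U u.
Hypothesis disc_U : forall p, sqnorm2 p <= 1 -> U (p.1 *: v + (p.2 *: v' + x)).
Hypothesis u_harmonic : forall (c d : R) y, sqnorm2 (c, d) = 1 -> U y ->
  'D_(c *: v + d *: v') ('D_(c *: v + d *: v') u) y +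
  'D_(c *: v' - d *: v) ('D_(c *: v' - d *: v) u) y = 0.
Hypothesis u_le : forall y, U y -> u y <= M.
Hypothesis u_max : u x = M.

Let e1 (q : R * R) : V := q.1 *: v + q.2 *: v'.
Let e2 (q : R * R) : V := q.1 *: v' - q.2 *: v.
(** Reading pairs as complex numbers and [v'] as i v, this is x + (p q) v: the point [p] of the disc
    after rotation by [q]. Multiplicativity of [sqnorm2] keeps it in the disc when [q] is on the
    circle. *)
Let pt (q p : R * R) : V := p.1 *: e1 q + (p.2 *: e2 q + x).

Let pt_U q p : sqnorm2 q = 1 -> sqnorm2 p <= 1 -> U (pt q p).
Proof.
move=> q1 p1; have := @disc_U (p.1 * q.1 - p.2 * q.2, p.1 * q.2 + p.2 * q.1).
have -> : (p.1 * q.1 - p.2 * q.2, p.1 * q.2 + p.2 * q.1).1 *: v +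
  ((p.1 * q.1 - p.2 * q.2, p.1 * q.2 + p.2 * q.1).2 *: v' + x) = pt q p.
  rewrite /pt /e1 /e2 /= scalerBl scalerDl !scalerBr !scalerDr !scalerA.
  rewrite !addrA; congr (_ + _); rewrite -!addrA; congr (_ + _).
  by rewrite [LHS]addrC -!addrA.
apply; suff -> : sqnorm2 (p.1 * q.1 - p.2 * q.2, p.1 * q.2 + p.2 * q.1) =
   sqnorm2 p * sqnorm2 q by rewrite q1 mulr1.
rewrite /sqnorm2 /=; ring.
Qed.

Let pt_continuous q : continuous (pt q).
Proof.
move=> p; rewrite /pt; apply: (@continuousD _ _ _ (fun p : R * R => p.1 *: e1 q)).
  by apply: cvgZr_tmp; exact: cvg_fst.
apply: (@continuousD _ _ _ (fun p : R * R => p.2 *: e2 q)); last exact: cvg_cst.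
by apply: cvgZr_tmp; exact: cvg_snd.
Qed.

Let u_pt_continuous q p : sqnorm2 q = 1 -> sqnorm2 p <= 1 ->
  {for p, continuous (u \o pt q)}.
Proof.
move=> q1 p1; apply: continuous_comp; first exact: pt_continuous.
by apply: differentiable_continuous; apply: u2.1; exact: pt_U.
Qed.

Let add_neq0 (a b c : R) :
  a + c * 2 <= 0 -> b + c * 2 <= 0 -> 0 < c -> a + b <> 0.
Proof. by move=> *; lra. Qed.

(* Since the circle is compact, finitely many rotations bring each of its
   points into the region where u < M, so the sum of the corresponding rotates
   of u - M, which vanishes at the centre, is negative on the whole circle.
   This contradicts the weak maximum principle. *)
Lemma harmonic_disc_max : u (v + x) = M.
Proof.
have vxU : U (v + x).
  have := @disc_U (1, 0); rewrite /= scale1r scale0r add0r; apply.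
  by rewrite /sqnorm2 /= expr1n expr0n addr0.
apply/eqP; rewrite eq_le u_le //= leNgt; apply/negP => uM.
pose C : set (R * R) := [set p | sqnorm2 p = 1].
pose O (q : R * R) : set (R * R) := [set p | u (pt q p) < M].
have cC : compact C.
  by apply: (@compact_sub_disc _ [set r | r = 1]); [exact: closed_eq|move=> r /= ->].
have covC := compact_cover_prod cC.
have /= [||D DC Dcov] := covC _ C (fun q => interior (O q)).
- by move=> q _; exact: open_interior.
(* The rotation by the conjugate of [p] sends [p] to 1, that is to the point [v + x], where [u < M]
   by assumption; continuity gives a neighbourhood. *)
- move=> p Cp; have Cq : C (p.1, - p.2) by rewrite /C /= /sqnorm2 /= sqrrN.
  exists (p.1, - p.2) => //; rewrite /O /interior /=.
  have Ep : pt (p.1, - p.2) p = v + x.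
    rewrite /pt /e1 /e2 /= !scaleNr opprK !scalerDr !scalerN !scalerA !addrA.
    rewrite (mulrC p.2 p.1) subrK -scalerDl -!expr2.
    by move: Cp; rewrite /C /= /sqnorm2 => ->; rewrite scale1r.
  have /cvgrPdist_lt := @u_pt_continuous _ p Cq (ltac:(by rewrite Cp)).
  rewrite /= Ep => /(_ (M - u (v + x))); rewrite subr_gt0 => /(_ uM).
  apply: filterS => p' /=; rewrite ltr_norml => /andP[]; lra.
pose l : seq (R * R) := finmap.enum_fset D.
have lC q : q \in l -> C q by move=> ql; have := DC q ql; rewrite inE.
pose Phi p := \sum_(q <- l) (u (pt q p) - M).
have cPhi p : sqnorm2 p <= 1 -> {for p, continuous Phi}.
  move=> p1; apply: continuous_seq_sum => q ql.
  by apply: continuousB; [apply: u_pt_continuous => //; exact: lC|exact: cst_continuous].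
have PhiC p : C p -> Phi p < 0.
  move=> Cp; have [q /= ql qp] := Dcov p Cp.
  rewrite /Phi (big_rem q) //= ltr_nwDl //.
    by rewrite subr_lt0; exact: (interior_subset qp).
  rewrite big_seq; apply: sumr_le0 => q' /mem_rem ql'; rewrite subr_le0; apply/u_le/pt_U.
    exact: lC.
  by rewrite Cp.
have Phi0 : Phi (0, 0) = 0.
  by rewrite /Phi big1_seq // => q _; rewrite /pt /= !scale0r !add0r u_max subrr.
have [|||p1 p1C p1max] := @compact_EVT_max _ _ Phi C.
- by exists (1, 0); rewrite /C /= /sqnorm2 /= expr1n expr0n addr0.
- exact: cC.
- by apply: continuous_in_subspaceT => p; rewrite inE /C /= => Cp; apply: cPhi; rewrite Cp.
rewrite inE in p1C.
(* [Phi p1] is the negative maximum over the circle. With half of its absolute value, [Psi] is at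
   most [Phi p1 / 2 < 0] on the circle while it is 0 at the centre, so its maximum over the disc is
   interior. *)
pose eps := - Phi p1 / 2.
have eps0 : 0 < eps by rewrite divr_gt0 // oppr_gt0 PhiC.
pose Psi p := Phi p + eps * sqnorm2 p.
have [|||p0 p0D p0max] := @compact_EVT_max _ _ Psi [set p | sqnorm2 p <= 1].
- by exists (0, 0); rewrite /= /sqnorm2 /= expr0n addr0.
- by apply: (@compact_sub_disc _ [set r | r <= 1]) => //; exact: closed_le.
- apply: continuous_in_subspaceT => p; rewrite inE /= => p1'.
  apply: continuousD; first exact: cPhi.
  by apply: continuousM; [exact: cst_continuous|exact: sqnorm2_continuous].
rewrite inE /= in p0D.
have Psi0 : 0 <= Psi p0.
  have := p0max (0, 0); rewrite inE /= {1}/sqnorm2 /= expr0n addr0 => /(_ ler01).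
  by rewrite {1}/Psi Phi0 add0r /sqnorm2 /= expr0n addr0 mulr0.
have p0lt : sqnorm2 p0 < 1.
  rewrite lt_neqAle p0D andbT; apply/eqP => Cp0.
  have := p1max p0; rewrite inE => /(_ Cp0) le1.
  by move: Psi0 eps0 le1; rewrite /Psi Cp0 /eps; lra.
(* Moving one coordinate by less than [e <= 1/4] raises the squared norm by at most 2 e + e^2 <= 3
   e, less than the available 4 e. *)
pose e := (1 - sqnorm2 p0) / 4.
have e0 : 0 < e by rewrite divr_gt0 // subr_gt0.
have [p01 p02] := sqnorm2_le1_bound p0D.
have near1 s : `|s - p0.1| < e -> sqnorm2 (s, p0.2) <= 1.
  move: p01 p02 e0; rewrite /e /sqnorm2 /= !ler_norml !ltr_norml => *; nra.
have near2 s : `|s - p0.2| < e -> sqnorm2 (p0.1, s) <= 1.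
  move: p01 p02 e0; rewrite /e /sqnorm2 /= !ler_norml !ltr_norml => *; nra.
have le1 : \sum_(q <- l) 'D_(e1 q) ('D_(e1 q) u) (pt q p0) + eps * 2 <= 0.
  apply: (@sum_second_derivative_le0 _ _ U u _ l e1 (fun q => p0.2 *: e2 q + x)
            M (p0.2 ^+ 2) eps p0.1 e u2 e0).
    move=> s se q ql; apply: (@pt_U q (s, p0.2)); first exact: lC.
    exact: near1.
  move=> s se; have := p0max (s, p0.2); rewrite inE; apply; exact: near1.
have le2 : \sum_(q <- l) 'D_(e2 q) ('D_(e2 q) u) (pt q p0) + eps * 2 <= 0.
  have ptE s q : s *: e2 q + (p0.1 *: e1 q + x) = pt q (p0.1, s).
    by rewrite /pt /= addrCA.
  rewrite (eq_bigr (fun q => 'D_(e2 q) ('D_(e2 q) u) (p0.2 *: e2 q + (p0.1 *: e1 q + x))));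
    last by move=> q _; rewrite ptE -surjective_pairing.
  apply: (@sum_second_derivative_le0 _ _ U u _ l e2 (fun q => p0.1 *: e1 q + x)
            M (p0.1 ^+ 2) eps p0.2 e u2 e0).
    move=> s se q ql; rewrite ptE; apply: pt_U; first exact: lC.
    exact: near2.
  move=> s se; under eq_bigr do rewrite ptE.
  under [X in _ <= X + _]eq_bigr do rewrite ptE -surjective_pairing.
  rewrite ![_ + p0.1 ^+ 2]addrC.
  have := p0max (p0.1, s); rewrite inE; apply; exact: near2.
(* Harmonicity makes the two sums of second derivatives cancel, whereas [le1] and [le2] bound their
   total by - 4 eps. *)
have : \sum_(q <- l) ('D_(e1 q) ('D_(e1 q) u) (pt q p0) +
                      'D_(e2 q) ('D_(e2 q) u) (pt q p0)) = 0.
  rewrite big1_seq // => q /andP[_ ql]; apply: u_harmonic.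
    by have := lC q ql; rewrite /C /=; case: (q).
  by apply: pt_U => //; exact: lC.
by rewrite big_split /=; exact: add_neq0 le1 le2 eps0.
Qed.

End Disc.

Lemma near_open (T : topologicalType) (U : set T) (x : T) (P : T -> Prop) :
  open U -> U x -> (forall y, U y -> P y) -> \near x, P x.
Proof. by move=> oU Ux UP; apply: filterS (open_nbhs_nbhs (conj oU Ux)). Qed.

(** With v' in the role of J v: D_v' D_v' u = - D_v' D_v w = - D_v D_v' w = - D_v D_v u, the middle
    equality being the symmetry of second derivatives. *)
Lemma cauchy_riemann_laplace (R : realType) (V : normedModType R) (U : set V)
    (u w : V -> R) (v v' x : V) : open U -> Ck_on 2 U u -> Ck_on 2 U w ->
  (forall y, U y -> 'D_v' u y = - 'D_v w y) ->
  (forall y, U y -> 'D_v' w y = 'D_v u y) ->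
  U x -> 'D_v ('D_v u) x + 'D_v' ('D_v' u) x = 0.
Proof.
move=> oU u2 w2 CR1 CR2 Ux.
have -> : 'D_v' ('D_v' u) x = 'D_v' (- 'D_v w) x.
  by apply: near_eq_derive; exact: (near_open oU Ux).
rewrite deriveN; last by apply: diff_derivable; exact: (proj1 (w2.2 v)).
rewrite (derive_comm v v' oU w2 Ux).
have -> : 'D_v ('D_v' w) x = 'D_v ('D_v u) x.
  by apply: near_eq_derive; exact: (near_open oU Ux).
exact: subrr.
Qed.

Lemma cauchy_riemann_strong_max (R : realType) (V : normedModType R)
    (J : {linear V -> V}) (U : set V) (u w : V -> R) (x : V) :
  continuous J -> (forall v, J (J v) = - v) ->
  open U -> Ck_on 2 U u -> Ck_on 2 U w ->
  (forall v y, U y -> 'D_(J v) u y = - 'D_v w y) ->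
  (forall v y, U y -> 'D_(J v) w y = 'D_v u y) ->
  U x -> (forall y, U y -> u y <= u x) -> \forall y \near x, u y = u x.
Proof.
move=> cJ JJ oU u2 w2 CR1 CR2 Ux umax.
have /nbhs_ballP[r /= r0 rU] := open_nbhs_nbhs (conj oU Ux).
have r20 : 0 < r / 2 by rewrite divr_gt0.
(* Both [v] and [J v] must be shorter than [r / 2]: the disc consists of the points p_1 v + p_2 J v
   + x with |p_1|, |p_2| <= 1, which then stay in the ball of radius [r]. *)
have Nv : \forall v \near (0 : V), `|v| < r / 2 /\ `|J v| < r / 2.
  have /cvgrPdist_lt /(_ _ r20) := cJ 0.
  have : \forall v \near (0 : V), `|v| < r / 2 by exact: nbhs0_lt.
  by apply: filterS2 => v ? /=; rewrite linear0 sub0r normrN.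
have : \forall y \near x, `|y - x| < r / 2 /\ `|J (y - x)| < r / 2.
  have : (fun y => y - x) y @[y --> x] --> (0 : V).
    by rewrite -(subrr x); apply: cvgB; [exact: cvg_id|exact: cvg_cst].
  by move=> /(_ _ Nv).
apply: filterS => y [y1 y2].
have := @harmonic_disc_max R V U u x (y - x) (J (y - x)) (u x) u2.
rewrite subrK; apply => //.
- move=> p /sqnorm2_le1_bound [p1 p2]; apply: rU; rewrite -ball_normE /ball_ /=.
  rewrite addrA opprD addrCA subrr addr0 normrN.
  apply: le_lt_trans (ler_normD _ _) _; rewrite !normrZ.
  have := normr_ge0 (y - x); have := normr_ge0 (J (y - x)); nra.
- move=> c d z _ Uz; have -> : c *: J (y - x) - d *: (y - x) =
      J (c *: (y - x) + d *: J (y - x)).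
    by rewrite (linearP J) (linearZ_LR J) JJ scalerN.
  apply: (cauchy_riemann_laplace oU u2 w2) => // z' Uz'; [exact: CR1|exact: CR2].
Qed.

(** * Calculus of C^k functions *)

(** [g - f] vanishes near [x], so it is a little-o of any order there and has differential 0; adding
    it to [f] preserves differentiability. *)
Lemma near_eq_differentiable (R : realType) (V W : normedModType R)
    (f g : V -> W) (x : V) :
  (\forall y \near x, f y = g y) -> differentiable f x -> differentiable g x.
Proof.
move=> fg df.
have -> : g = f + (g - f) by rewrite addrC subrK.
apply: differentiableD => //.
have h0 : (g - f) \o shift x = cst ((g - f) x) + \0 +o_ (0 : V) id.
  apply/eqaddoP => _/posnumP[e].
  have : (fun h : V => h + x) h @[h --> (0 : V)] --> 0 + x.
    by apply: cvgD; [exact: cvg_id|exact: cvg_cst].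
  rewrite add0r => /(_ _ fg) near_fg; near=> h.
  have fgh : f (h + x) = g (h + x) by near: h.
  rewrite /= /cst /shift /= !fctE /= fgh (nbhs_singleton fg) !subrr.
  by rewrite addr0 subrr normr0 mulr_ge0.
have c0 : continuous (\0 : V -> W) by exact: cst_continuous.
by apply/diff_locallyP; rewrite (@diff_unique _ _ _ _ \0 _ c0 h0).
Unshelve. all: by end_near. Qed.

Section CkOperations.
Variables (R : realType) (V : normedModType R).
Implicit Types (W : normedModType R) (U : set V) (k : nat).

Lemma Ck_on_sub W k U U' (f : V -> W) : U' `<=` U -> Ck_on k U f -> Ck_on k U' f.
Proof.
move=> sU; elim: k f => [|k IH] f /=; first by move=> cf x /sU /cf.
by move=> [df ddf]; split=> [x /sU /df //|v]; exact: IH.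
Qed.

Lemma Ck_on_local W k U (f : V -> W) :
  (forall x, U x -> exists U', [/\ open U', U' x & Ck_on k U' f]) -> Ck_on k U f.
Proof.
elim: k f => [|k IH] f loc /=; first by move=> x /loc [U' [_ U'x cf]]; exact: cf.
split=> [x /loc [U' [_ U'x [df _]]]|v]; first exact: df.
by apply: IH => x /loc [U' [oU' U'x [_ ddf]]]; exists U'; split=> //; exact: ddf.
Qed.

Lemma Ck_on_eq W k U (f g : V -> W) : open U ->
  (forall x, U x -> f x = g x) -> Ck_on k U f -> Ck_on k U g.
Proof.
move=> oU; elim: k f g => [|k IH] f g fg /=.
  move=> cf x Ux; have := cf x Ux; rewrite /prop_for /continuous_at -fg //.
  by apply: cvg_trans; apply: near_eq_cvg; exact: (near_open oU Ux).
move=> [df ddf]; split=> [x Ux|v].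
  by apply: near_eq_differentiable (df x Ux); exact: (near_open oU Ux).
apply: IH (ddf v) => x Ux; apply: near_eq_derive; exact: (near_open oU Ux).
Qed.

Lemma Ck_on_cst W k U (c : W) : Ck_on k U (fun=> c).
Proof.
elim: k c => [|k IH] c /=; first by move=> x _; exact: cst_continuous.
split=> [x _|v]; first exact: differentiable_cst.
have -> : 'D_v (fun=> c) = (fun=> 0) :> (V -> W) by apply/funext => x; exact: derive_cst.
exact: IH.
Qed.

Lemma Ck_onD W k U (f g : V -> W) : open U ->
  Ck_on k U f -> Ck_on k U g -> Ck_on k U (fun x => f x + g x).
Proof.
move=> oU; elim: k f g => [|k IH] f g /=.
  by move=> cf cg x Ux; apply: continuousD; [exact: cf|exact: cg].
move=> [df ddf] [dg ddg]; split=> [x Ux|v].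
  by apply: differentiableD; [exact: df|exact: dg].
apply: Ck_on_eq (IH _ _ (ddf v) (ddg v)) => // x Ux.
by rewrite deriveD //; apply: diff_derivable; [exact: df|exact: dg].
Qed.

Lemma Ck_onN W k U (f : V -> W) : open U ->
  Ck_on k U f -> Ck_on k U (fun x => - f x).
Proof.
move=> oU; elim: k f => [|k IH] f /=.
  by move=> cf x Ux; apply: continuousN; exact: cf.
move=> [df ddf]; split=> [x Ux|v]; first by apply: differentiableN; exact: df.
apply: Ck_on_eq (IH _ (ddf v)) => // x Ux.
by rewrite deriveN //; apply: diff_derivable; exact: df.
Qed.

Lemma Ck_onM k U (f g : V -> R) : open U ->
  Ck_on k U f -> Ck_on k U g -> Ck_on k U (fun x => f x * g x).
Proof.
move=> oU; elim: k f g => [|k IH] f g; first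
  by move=> cf cg x Ux; apply: continuousM; [exact: cf|exact: cg].
move=> Cf Cg; have [df ddf] := Cf; have [dg ddg] := Cg; split=> [x Ux|v].
  by apply: differentiableM; [exact: df|exact: dg].
have := Ck_onD oU (IH _ _ (Ck_on1 Cf) (ddg v)) (IH _ _ (Ck_on1 Cg) (ddf v)).
apply: Ck_on_eq => // x Ux.
by rewrite deriveM //; apply: diff_derivable; [exact: df|exact: dg].
Qed.

Lemma Ck_onV k U (f : V -> R) : open U -> (forall x, U x -> f x != 0) ->
  Ck_on k U f -> Ck_on k U (fun x => (f x)^-1).
Proof.
move=> oU f0; elim: k => [|k IH]; first
  by move=> cf x Ux; apply: continuousV; [exact: f0|exact: cf].
move=> Cf; have [df ddf] := Cf; split=> [x Ux|v].
  by apply: differentiableV; [exact: df|exact: f0].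
have CV := IH (Ck_on1 Cf).
have := Ck_onN oU (Ck_onM oU (Ck_onM oU CV CV) (ddf v)).
apply: Ck_on_eq => // x Ux.
rewrite deriveV ?f0 //; last by apply: diff_derivable; exact: df.
by rewrite /GRing.scale /= expr2 invfM mulNr.
Qed.

Lemma Ck_on_sum k U (I : Type) (l : seq I) (f : I -> V -> R) : open U ->
  (forall i, Ck_on k U (f i)) -> Ck_on k U (fun x => \sum_(i <- l) f i x).
Proof.
move=> oU Cf; elim: l => [|i l IH].
  apply: (Ck_on_eq oU _ (Ck_on_cst k U (0 : R))) => x _; by rewrite big_nil.
by apply: (Ck_on_eq oU _ (Ck_onD oU (Cf i) IH)) => x _; rewrite big_cons.
Qed.

Lemma differentiable_row_coord m (g : V -> 'rV[R]_m) (j : 'I_m) x :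
  differentiable g x -> differentiable (fun x => g x 0 j) x.
Proof.
move=> dg; apply: (differentiable_comp dg (g := fun y : 'rV[R]_m => y 0 j)).
exact: differentiable_coord.
Qed.

Lemma Ck_on_coord m k U (g : V -> 'rV[R]_m) (j : 'I_m) : open U ->
  Ck_on k U g -> Ck_on k U (fun x => g x 0 j).
Proof.
move=> oU; elim: k g => [|k IH] g /=.
  move=> cg x Ux; apply: (continuous_comp (cg x Ux) (g := fun y : 'rV[R]_m => y 0 j)).
  exact: coord_continuous.
move=> [dg ddg]; split=> [x Ux|v]; first by apply: differentiable_row_coord; exact: dg.
apply: (Ck_on_eq oU _ (IH _ (ddg v))) => x Ux.
by rewrite derive_mx ?mxE //; apply: diff_derivable; exact: dg.
Qed.

Lemma derive_comp W (W' : normedModType R) (f : W -> W') (g : V -> W) (v x : V) :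
  differentiable g x -> differentiable f (g x) ->
  'D_v (f \o g) x = 'D_('D_v g x) f (g x).
Proof.
move=> dg df; rewrite !deriveE //; last exact: differentiable_comp.
by rewrite diff_comp.
Qed.

Lemma derive_row_sum m W (f : 'rV[R]_m -> W) (a y : 'rV[R]_m) :
  differentiable f y -> 'D_a f y = \sum_j a 0 j *: 'D_(delta_mx 0 j) f y.
Proof.
move=> df; rewrite deriveE // {1}[a]row_sum_delta linear_sum /=.
by apply: eq_bigr => j _; rewrite linearZ /= deriveE.
Qed.

Lemma Ck_on_comp m k U (U' : set 'rV[R]_m) (f : 'rV[R]_m -> R) (g : V -> 'rV[R]_m) :
  open U -> (forall x, U x -> U' (g x)) -> Ck_on k U' f -> Ck_on k U g ->
  Ck_on k U (f \o g).
Proof.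
move=> oU gU; elim: k f g gU => [|k IH] f g gU.
  by move=> cf cg x Ux; apply: continuous_comp; [exact: cg|exact/cf/gU].
move=> [df ddf] Cg; have [dg ddg] := Cg; split=> [x Ux|v].
  by apply: differentiable_comp; [exact: dg|exact/df/gU].
(* The chain rule differentiates [f] in the direction ['D_v g x], which varies with [x], while
   [Ck_on] controls constant directions only; expanding that direction in the standard basis
   restores the inductive shape. *)
have := @Ck_on_sum k U _ (index_enum 'I_m)
  (fun j x => 'D_v g x 0 j * ('D_(delta_mx 0 j) f \o g) x) oU.
move=> H; apply: (Ck_on_eq oU _ (H _)) => [x Ux|j].
  by rewrite (derive_comp v (dg x Ux) (df _ (gU x Ux))) (derive_row_sum _ (df _ (gU x Ux))).
apply: Ck_onM => //; first exact: (Ck_on_coord j oU (ddg v)).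
exact: (IH _ _ gU (ddf _) (Ck_on1 Cg)).
Qed.

End CkOperations.

(** * Functions on manifolds *)

Lemma mulmxr_continuous (R : realType) (m n : nat) (A : 'M[R]_(m, n)) :
  continuous (fun v : 'rV[R]_m => v *m A).
Proof.
move=> v; rewrite (_ : (fun _ => _) = fun v : 'rV_m => \sum_j v 0 j *: row j A).
  apply: continuous_seq_sum => j _; 
  have cj : {for v, continuous (fun w : 'rV[R]_m => w 0 j)} by exact: coord_continuous.
  apply: (continuous_comp cj (g := fun k : R => k *: row j A)).
  exact: scalel_continuous.
by apply/funext => w; rewrite mulmx_sum_row.
Qed.

Lemma jacobian_cancel (R : realType) (m n : nat)
    (f : 'rV[R]_m -> 'rV[R]_n) (g : 'rV[R]_n -> 'rV[R]_m) (x : 'rV[R]_m) :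
  differentiable f x -> differentiable g (f x) ->
  (\forall y \near x, g (f y) = y) -> 'J f x *m 'J g (f x) = 1%:M.
Proof.
move=> df dg gf; apply/row_matrixP => i; rewrite !rowE mulmxA mulmx1.
rewrite -!deriveEjacobian // -derive_comp //.
by rewrite (near_eq_derive _ (g := id)) // derive_id.
Qed.

Lemma jacobian_near_id (R : realType) (m : nat) (f : 'rV[R]_m -> 'rV[R]_m) x :
  (\forall y \near x, f y = y) -> 'J f x = 1%:M.
Proof.
move=> fid; have df : differentiable f x.
  apply: (near_eq_differentiable (f := id)); first by apply: filterS fid.
  exact: ex_diff.
apply/row_matrixP => i; rewrite !rowE mulmx1 -deriveEjacobian //.
by rewrite (near_eq_derive _ (g := id)) // derive_id.
Qed.

Section ManifoldCalculus.
Variables (R : realType) (m : nat) (M : topologicalType) (D : manifold R m M).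
Implicit Types (phi psi : chart R m M) (p q : M) (x y v : 'rV[R]_m).

Lemma open_chart_preimage phi (A : set M) : open A ->
  open [set x | cimg phi x /\ A (cinv phi x)].
Proof.
move=> oA; rewrite openE => x [ix Ax].
have n1 : nbhs x (cimg phi) := open_nbhs_nbhs (conj (@cimg_open _ _ _ phi) ix).
have n2 : nbhs x (cinv phi @^-1` A).
  exact: (cinv_continuous ix (open_nbhs_nbhs (conj oA Ax))).
exact: filterI n1 n2.
Qed.

Lemma open_overlap phi psi : open (overlap phi psi).
Proof. exact: open_chart_preimage (@cdom_open _ _ _ psi). Qed.

Lemma nbhs_overlap phi psi x : overlap phi psi x -> nbhs x (overlap phi psi).
Proof. by move=> ox; apply: open_nbhs_nbhs; split; first exact: open_overlap. Qed.

Lemma smooth_chart_at p : smooth_chart D (chart_at D p).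
Proof. by move=> q; split; exact: chart_at_compat. Qed.

Lemma overlap_cancel phi psi x : overlap phi psi x ->
  \forall y \near x, cmap phi (cinv psi (cmap psi (cinv phi y))) = y.
Proof.
move=> ox; apply: filterS (nbhs_overlap ox) => y [iy dy].
by rewrite cmapK // cinvK.
Qed.

Lemma smooth_on_differentiable (V W : normedModType R) (U : set V) (f : V -> W) a :
  smooth_on U f -> U a -> differentiable f a.
Proof. by move=> sf Ua; case: (sf 1%N) => + _; exact. Qed.

Lemma overlap_at phi q : cdom phi q -> overlap phi (chart_at D q) (cmap phi q).
Proof.
by move=> dq; split; [exact: cmap_img|rewrite cmapK //; exact: mem_chart_at].
Qed.

Lemma overlap_at_sym phi q : cdom phi q ->
  overlap (chart_at D q) phi (cmap (chart_at D q) q).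
Proof.
move=> dq; have dqq := mem_chart_at D q.
by split; [exact: cmap_img|rewrite cmapK].
Qed.

Lemma chart_param_tangent phi q : smooth_chart D phi -> cdom phi q ->
  chart_tangent D phi q *m param_tangent D phi (cmap phi q) = 1%:M.
Proof.
move=> sphi dq; have [s1 s2] := sphi q; have dqq := mem_chart_at D q.
rewrite /chart_tangent /param_tangent cmapK //.
have E : (cmap phi \o cinv (chart_at D q)) (cmap (chart_at D q) q) = cmap phi q.
  by rewrite /= cmapK.
rewrite -E; apply: jacobian_cancel.
- exact: smooth_on_differentiable s1 (overlap_at_sym dq).
- rewrite E; exact: smooth_on_differentiable s2 (overlap_at dq).
- exact: overlap_cancel (overlap_at_sym dq).
Qed.

Lemma param_tangent_unit phi x : smooth_chart D phi -> cimg phi x ->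
  param_tangent D phi x \in unitmx.
Proof.
move=> sphi ix; have := chart_param_tangent sphi (cinv_dom ix).
by rewrite cinvK // => /mulmx1_unit[].
Qed.

(** Tangent vectors at [p] are by convention coordinates in [chart_at D p]; at [p] itself,
    expressing a form in this chart therefore changes nothing. *)
Lemma param_tangent_at p :
  param_tangent D (chart_at D p) (cmap (chart_at D p) p) = 1%:M.
Proof.
have dp := mem_chart_at D p; rewrite /param_tangent cmapK //.
apply: jacobian_near_id; have N := nbhs_overlap (overlap_at_sym dp).
by apply: filterS N => y [iy _] /=; rewrite cinvK.
Qed.

Definition smooth_real (u : M -> R) : Prop :=
  forall p, smooth_on (cimg (chart_at D p)) (u \o cinv (chart_at D p)).

Definition differential (u : M -> R) (p : M) (v : 'rV[R]_m) : R :=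
  'D_v (u \o cinv (chart_at D p)) (cmap (chart_at D p) p).

Lemma chart_at_factor phi q (T : Type) (u : M -> T) x :
  overlap phi (chart_at D q) x ->
  (u \o cinv (chart_at D q)) ((cmap (chart_at D q) \o cinv phi) x) = u (cinv phi x).
Proof. by move=> [_ dx]; rewrite /= cmapK. Qed.

Lemma smooth_real_in_chart phi (u : M -> R) : smooth_chart D phi ->
  smooth_real u -> smooth_on (cimg phi) (u \o cinv phi).
Proof.
move=> sphi su k; apply: Ck_on_local => x ix.
have dx := cinv_dom ix; have [_ s2] := sphi (cinv phi x).
exists (overlap phi (chart_at D (cinv phi x))); split.
- exact: open_overlap.
- by have := overlap_at dx; rewrite cinvK.
apply: (Ck_on_eq (@open_overlap _ _) (@chart_at_factor _ _ _ u)).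
apply: (Ck_on_comp (@open_overlap _ _) _ (su (cinv phi x) k) (s2 k)).
by move=> y [_ dy]; exact: cmap_img.
Qed.

(** [differential] is tied to the preferred chart of each point, which changes from point to point;
    this transports it to a single chart, where the maximum principle can be applied. *)
Lemma derive_in_chart phi (u : M -> R) x v : smooth_chart D phi ->
  smooth_real u -> cimg phi x ->
  'D_v (u \o cinv phi) x = differential u (cinv phi x) (v *m param_tangent D phi x).
Proof.
move=> sphi su ix; set q := cinv phi x.
have dq : cdom phi q := cinv_dom ix; have [_ s2] := sphi q.
have ox : overlap phi (chart_at D q) x by have := overlap_at dq; rewrite cinvK.
have df := smooth_on_differentiable s2 ox.
rewrite /differential /param_tangent -deriveEjacobian // -/q.
have <- : (cmap (chart_at D q) \o cinv phi) x = cmap (chart_at D q) q by [].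
rewrite -derive_comp //; last first.
  by apply: smooth_on_differentiable (su q) _; apply/cmap_img/mem_chart_at.
apply: near_eq_derive; apply: filterS (nbhs_overlap ox) => y oy.
by rewrite /= -(chart_at_factor u oy).
Qed.

Lemma smooth_real_continuous (u : M -> R) : smooth_real u -> continuous u.
Proof.
move=> su p; have dp := mem_chart_at D p.
have : {for p, continuous ((u \o cinv (chart_at D p)) \o cmap (chart_at D p))}.
  apply: continuous_comp; first exact: cmap_continuous.
  by apply: (su p 0%N); exact: cmap_img.
rewrite /prop_for /continuous_at /= cmapK //; apply: cvg_trans.
apply: near_eq_cvg; apply: (near_open (@cdom_open _ _ _ (chart_at D p)) dp) => q dq.
by rewrite /= cmapK.
Qed.

Lemma smooth_realN (u : M -> R) : smooth_real u -> smooth_real (fun p => - u p).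
Proof. by move=> su p k; apply: Ck_onN (su p k); exact: cimg_open. Qed.

Lemma differentialN (u : M -> R) p v : smooth_real u ->
  differential (fun p => - u p) p v = - differential u p v.
Proof.
move=> su; rewrite /differential -deriveN //; apply: diff_derivable.
by apply: smooth_on_differentiable (su p) _; apply/cmap_img/mem_chart_at.
Qed.

End ManifoldCalculus.

(** * Holomorphic functions on compact connected manifolds *)

Lemma std_J_sqr (R : realType) (n : nat) : std_J R n *m std_J R n = - 1%:M.
Proof.
rewrite /std_J mulmx_block !mulmx0 !mul0mx !mulmxN !mulNmx !mulmx1 !add0r !addr0.
by rewrite scalar_mx_block opp_block_mx oppr0.
Qed.

Lemma conj_mulmx (R : realType) (m : nat) (T P K S : 'M[R]_m) :
  T *m P = 1%:M -> K *m T = T *m S -> S *m P = P *m K.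
Proof.
move=> TP KT; have PT := mulmx1C TP.
by rewrite -[S]mul1mx -PT -(mulmxA P) -KT -!mulmxA TP mulmx1.
Qed.

Section HolomorphicConstant.
Variables (R : realType) (n : nat) (M : topologicalType).
Variables (D : manifold R (n + n) M) (J : complex_structure D).

(** For h = u + i w this says dh(J v) = i dh(v), split into real and imaginary parts. *)
Definition cauchy_riemann (u w : M -> R) : Prop := forall p v,
  differential D u p (v *m J p) = - differential D w p v /\
  differential D w p (v *m J p) = differential D u p v.

(* If h = u + i w, this is the pair of - i h. *)
Lemma cauchy_riemann_rot (u w : M -> R) : smooth_real D u ->
  cauchy_riemann u w -> cauchy_riemann w (fun p => - u p).
Proof.
move=> su CR p v; have [c1 c2] := CR p v.
by rewrite !differentialN // c1 c2 !opprK.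
Qed.

Lemma param_tangent_holomorphic (phi : chart R (n + n) M) q :
  smooth_chart D phi -> cdom phi q ->
  J q *m chart_tangent D phi q = chart_tangent D phi q *m std_J R n ->
  std_J R n *m param_tangent D phi (cmap phi q) =
  param_tangent D phi (cmap phi q) *m J q.
Proof.
move=> sphi dq Jphi; have TP := chart_param_tangent sphi dq.
exact: conj_mulmx TP Jphi.
Qed.

Lemma cauchy_riemann_open_max (u w : M -> R) (p : M) :
  smooth_real D u -> smooth_real D w -> cauchy_riemann u w ->
  (forall q, u q <= u p) -> \forall q \near p, u q = u p.
Proof.
move=> su sw CR umax; have [phi [sphi dp Jphi]] := cs_integrable J p.
(* One transport statement for both equations: it is used with (f, g) = (u, - w) and with (f, g) =
   (w, u). In the chart [phi] the varying [J] becomes the constant matrix [std_J]. *)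
have dC f g v y : smooth_real D f -> smooth_real D g ->
    (forall q z, differential D f q (z *m J q) = differential D g q z) ->
    cimg phi y -> 'D_(v *m std_J R n) (f \o cinv phi) y = 'D_v (g \o cinv phi) y.
  move=> sf sg fg iy; rewrite !(derive_in_chart _ sphi) // -mulmxA.
  have := param_tangent_holomorphic sphi (cinv_dom iy) (Jphi _ (cinv_dom iy)).
  by rewrite cinvK // => ->; rewrite mulmxA fg.
have N : \forall y \near cmap phi p, (u \o cinv phi) y = (u \o cinv phi) (cmap phi p).
  apply: (@cauchy_riemann_strong_max _ _ (mulmxr (std_J R n)) (cimg phi) _ (w \o cinv phi)).
  - exact: mulmxr_continuous.
  - by move=> v /=; rewrite -mulmxA std_J_sqr mulmxN mulmx1.
  - exact: cimg_open.
  - exact: smooth_real_in_chart su 2%N.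
  - exact: smooth_real_in_chart sw 2%N.
  - move=> v y iy; rewrite /= (dC u (fun p => - w p)) ?deriveN //.
    + apply: diff_derivable.
      exact: smooth_on_differentiable (smooth_real_in_chart sphi sw) iy.
    + exact: smooth_realN.
    + by move=> q z; rewrite differentialN // (CR q z).1.
  - by move=> v y iy; apply: dC => // q z; rewrite (CR q z).2.
  - exact: cmap_img.
  - by move=> y iy /=; rewrite cmapK.
have := cmap_continuous dp N; rewrite /= cmapK // => N'.
have N2 : nbhs p (cdom phi) by apply: open_nbhs_nbhs; split; first exact: cdom_open.
by near=> q; have : u (cinv phi (cmap phi q)) = u p; [near: q|rewrite cmapK //; near: q].
Unshelve. all: by end_near. Qed.

(** By compactness [u] attains a maximum; the set where it does is closed by continuity and open by
    the strong maximum principle, hence everything. *)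
Lemma cauchy_riemann_constant (u w : M -> R) :
  compact [set: M] -> connected [set: M] ->
  smooth_real D u -> smooth_real D w -> cauchy_riemann u w ->
  forall p q, u p = u q.
Proof.
move=> cM kM su sw CR; suff : forall p0 : M, exists c, forall p, u p = c.
  by move=> H p q; have [c cE] := H p; rewrite !cE.
move=> p0; have cu := smooth_real_continuous su.
have [|||pm _ pmax] := @compact_EVT_max _ _ u setT.
- by exists p0.
- exact: cM.
- exact: continuous_subspaceT.
exists (u pm); have umax q : u q <= u pm by apply: pmax; rewrite inE.
suff /seteqP[_ E] : [set q | u q = u pm] = setT by move=> q; exact: E.
apply: kM.
- by exists pm.
- exists [set q | u q = u pm]; last by rewrite setTI.
  rewrite openE => q /= uq; rewrite /interior -uq.
  by apply: cauchy_riemann_open_max sw CR _ => // q'; rewrite uq.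
- exists [set q | u q = u pm]; last by rewrite setTI.
  by apply: (@preimage_closed _ _ u [set r | r = u pm]) => //; exact: closed_eq.
Qed.

End HolomorphicConstant.

(** * Closed multiples of an (n,0)-form *)

Section ZeroWedge.
Variables (R : realType) (n m : nat) (K : 'M[R]_m).
Variables (theta : 'rV[R]_m -> R[i]) (s : 'M[R]_(n, m) -> R[i]).

Definition type_k0 : Prop := forall (A B : 'M[R]_(n, m)) (i0 : 'I_n),
  row i0 B = row i0 A *m K -> row' i0 B = row' i0 A -> s A + 'i%C * s B = 0.

Lemma type_k0_mul A B i0 : type_k0 ->
  row i0 B = row i0 A *m K -> row' i0 B = row' i0 A -> s B = 'i%C * s A.
Proof.
move=> k0 rB r'B; have /eqP := k0 A B i0 rB r'B.
by rewrite addr_eq0 => /eqP ->; rewrite mulrN mulrA -expr2 sqr_i mulN1r opprK.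
Qed.

Definition prepend_row (v : 'rV[R]_m) (B : 'M[R]_(n, m)) : 'M[R]_(n.+1, m) :=
  \matrix_(i, k) if unlift ord0 i is Some j then B j k else v 0 k.

Lemma prepend_row0 v B : row ord0 (prepend_row v B) = v.
Proof. by apply/rowP => k; rewrite !mxE unlift_none. Qed.

Lemma prepend_row'0 v B : row' ord0 (prepend_row v B) = B.
Proof. by apply/matrixP => j k; rewrite !mxE liftK. Qed.

Lemma prepend_rowS v B j : row (lift ord0 j) (prepend_row v B) = row j B.
Proof. by apply/rowP => k; rewrite !mxE liftK. Qed.

(** Deleting a row of [B] leaves [v] in the top slot. That slot is an [i0] of value 0 because [n] is
    not syntactically a successor. *)
Lemma prepend_row'S v B j (i0 : 'I_n) : i0 = 0%N :> nat ->
  row i0 (row' (lift ord0 j) (prepend_row v B)) = v.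
Proof.
move=> i00; apply/rowP => k; rewrite !mxE.
have -> : lift (lift ord0 j) i0 = ord0 by apply: val_inj; rewrite /= i00.
by rewrite unlift_none.
Qed.

Lemma prepend_row'S' v v' B j (i0 : 'I_n) : i0 = 0%N :> nat ->
  row' i0 (row' (lift ord0 j) (prepend_row v B)) =
  row' i0 (row' (lift ord0 j) (prepend_row v' B)).
Proof.
move=> i00; apply/matrixP => k l; rewrite !mxE.
by case: unliftP => // /(congr1 val) /=; rewrite /bump i00 /=; case: leqP.
Qed.

(* Apply the vanishing of theta /\ s to (v K, b_1, .., b_n) and to
   (v, b_1, .., b_n), and subtract 'i times the second relation: only the terms
   in theta (v K) and theta v survive. *)
Lemma zero_wedge_k0 (B : 'M[R]_(n, m)) (v : 'rV[R]_m) : type_k0 ->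
  (forall A : 'M[R]_(n.+1, m),
     \sum_(i < n.+1) (-1) ^+ i * (theta (row i A) * s (row' i A)) = 0) ->
  s B != 0 -> theta (v *m K) = 'i%C * theta v.
Proof.
move=> k0 wedge0 sB; apply: (mulIf sB).
have := wedge0 (prepend_row v B); have := wedge0 (prepend_row (v *m K) B).
rewrite !big_ord_recl !expr0 !mul1r !prepend_row0 !prepend_row'0.
move=> /eqP; rewrite addr_eq0 => /eqP -> /eqP; rewrite addr_eq0 -mulrA => /eqP ->.
rewrite mulrN mulr_sumr; congr (- _); apply: eq_bigr => j _.
rewrite !prepend_rowS.
(* The summation index [j : 'I_n] itself provides a slot 0 for [v]; for n = 0 the sum is empty. *)
have n0 : (0 < n)%N by case: (n) j => // -[].
rewrite (@type_k0_mul (row' (lift ord0 j) (prepend_row v B)) _ (Ordinal n0)) //.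
- by rewrite !(mulrCA _ 'i%C).
- by rewrite !prepend_row'S.
- exact: prepend_row'S'.
Qed.

End ZeroWedge.

(** * Products and inverses of complex-valued functions *)

Section DeriveC.
Variables (R : realType) (V : normedModType R).

Definition differentiable_C (f : V -> R[i]) (x : V) : Prop :=
  differentiable (fun y => complex.Re (f y) : R) x /\
  differentiable (fun y => complex.Im (f y) : R) x.

Lemma smooth_on_C_differentiable (U : set V) (f : V -> R[i]) x :
  smooth_on_C U f -> U x -> differentiable_C f x.
Proof. by move=> [fr fi] Ux; split; apply: smooth_on_differentiable Ux. Qed.

Lemma differentiable_CM (f g : V -> R[i]) x : differentiable_C f x ->
  differentiable_C g x -> differentiable_C (fun y => f y * g y) x.
Proof.
move=> [fr fi] [gr gi]; split.
- rewrite (_ : (fun _ => _) = fun y => complex.Re (f y) * complex.Re (g y) -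
      complex.Im (f y) * complex.Im (g y)); last first.
    by apply/funext => y; case: (f y) (g y) => [a b] [c d].
  by apply: differentiableB; apply: differentiableM.
- rewrite (_ : (fun _ => _) = fun y => complex.Re (f y) * complex.Im (g y) +
      complex.Im (f y) * complex.Re (g y)); last first.
    by apply/funext => y; case: (f y) (g y) => [a b] [c d].
  by apply: differentiableD; apply: differentiableM.
Qed.

Lemma derive_CM (f g : V -> R[i]) (v x : V) :
  differentiable_C f x -> differentiable_C g x ->
  derive_C (fun y => f y * g y) v x = derive_C f v x * g x + f x * derive_C g v x.
Proof.
move=> [fr fi] [gr gi]; rewrite /derive_C.
have -> : (fun y => complex.Re (f y * g y) : R) =
    (fun y => complex.Re (f y) * complex.Re (g y) -
      complex.Im (f y) * complex.Im (g y)).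
  by apply/funext => y; case: (f y) (g y) => [a b] [c d].
have -> : (fun y => complex.Im (f y * g y) : R) =
    (fun y => complex.Re (f y) * complex.Im (g y) +
      complex.Im (f y) * complex.Re (g y)).
  by apply/funext => y; case: (f y) (g y) => [a b] [c d].
have H := @diff_derivable R V R.
rewrite deriveB ?deriveD; try (by apply: derivableM; apply: H).
rewrite !deriveM; try exact: H.
case: (f x) (g x) => [a b] [c d]; apply/eqP; rewrite eq_complex /= /GRing.scale /=.
by apply/andP; split; apply/eqP; ring.
Qed.

End DeriveC.

Section SmoothC.
Variables (R : realType) (V : normedModType R).
Implicit Types (U : set V) (f g : V -> R[i]).

Lemma smooth_onV U (f : V -> R) : open U -> (forall x, U x -> f x != 0) ->
  smooth_on U f -> smooth_on U (fun x => (f x)^-1).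
Proof. by move=> oU f0 sf k; apply: Ck_onV. Qed.

Lemma smooth_onM U (f g : V -> R) : open U -> smooth_on U f -> smooth_on U g ->
  smooth_on U (fun x => f x * g x).
Proof. by move=> oU sf sg k; apply: Ck_onM. Qed.

Lemma smooth_onD U (f g : V -> R) : open U -> smooth_on U f -> smooth_on U g ->
  smooth_on U (fun x => f x + g x).
Proof. by move=> oU sf sg k; apply: Ck_onD. Qed.

Lemma smooth_onN U (f : V -> R) : open U -> smooth_on U f ->
  smooth_on U (fun x => - f x).
Proof. by move=> oU sf k; apply: Ck_onN. Qed.

Lemma smooth_on_eq (W : normedModType R) U (f g : V -> W) : open U ->
  (forall x, U x -> f x = g x) -> smooth_on U f -> smooth_on U g.
Proof. by move=> oU fg sf k; apply: Ck_on_eq fg _. Qed.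

Lemma smooth_on_CM U f g : open U -> smooth_on_C U f -> smooth_on_C U g ->
  smooth_on_C U (fun x => f x * g x).
Proof.
move=> oU [fr fi] [gr gi]; split.
- apply: (smooth_on_eq oU _ (smooth_onD oU (smooth_onM oU fr gr)
    (smooth_onN oU (smooth_onM oU fi gi)))) => x _.
  by case: (f x) (g x) => [a b] [c d].
- apply: (smooth_on_eq oU _ (smooth_onD oU (smooth_onM oU fr gi)
    (smooth_onM oU fi gr))) => x _.
  by case: (f x) (g x) => [a b] [c d].
Qed.

(** 1 / f is the conjugate of f divided by |f|^2, and |f|^2 is a smooth real function without zeros
    on [U]. *)
Lemma smooth_on_CV U f : open U -> (forall x, U x -> f x != 0) ->
  smooth_on_C U f -> smooth_on_C U (fun x => (f x)^-1).
Proof.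
move=> oU f0 [fr fi].
have sn := smooth_onD oU (smooth_onM oU fr fr) (smooth_onM oU fi fi).
have sV := smooth_onV oU _ sn.
have {}sV : smooth_on U (fun x => (complex.Re (f x) * complex.Re (f x) +
    complex.Im (f x) * complex.Im (f x))^-1).
  apply: sV => x /f0; case: (f x) => a b /=; rewrite eq_complex /= => ab.
  by rewrite paddr_eq0 -?expr2 ?sqr_ge0 // !sqrf_eq0.
split.
- apply: (smooth_on_eq oU _ (smooth_onM oU fr sV)) => x _.
  by case: (f x) => [a b] /=; rewrite -!expr2.
- apply: (smooth_on_eq oU _ (smooth_onN oU (smooth_onM oU fi sV))) => x _.
  by case: (f x) => [a b] /=; rewrite -!expr2.
Qed.

End SmoothC.

Section ClosedMultiples.
Variables (R : realType) (n : nat) (M : topologicalType).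
Variables (D : manifold R (n + n) M) (J : complex_structure D).

Lemma cauchy_riemann_of_closed (sigma : preform R n (n + n) M)
    (f h : M -> R[i]) :
  is_k0_form J sigma -> nowhere_vanishing sigma ->
  smooth_fun_C D f -> (forall p, f p != 0) -> smooth_fun_C D h ->
  closed_form D (scale_form f sigma) ->
  closed_form D (scale_form (fun p => h p * f p) sigma) ->
  cauchy_riemann J (fun p => complex.Re (h p)) (fun p => complex.Im (h p)).
Proof.
move=> [[alt ssigma] k0] nv sf f0 sh cf chf p v.
set phi := chart_at D p; set x := cmap phi p.
have ix : cimg phi x by apply/cmap_img/mem_chart_at.
have xK : cinv phi x = p by apply: cmapK; exact: mem_chart_at.
pose theta v := derive_C (h \o cinv phi) v x.
have dh : differentiable_C (h \o cinv phi) x := smooth_on_C_differentiable (sh p) ix.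
have df : differentiable_C (f \o cinv phi) x := smooth_on_C_differentiable (sf p) ix.
have ds A : differentiable_C (form_in D phi sigma ^~ A) x.
  exact: smooth_on_C_differentiable (ssigma p A) ix.
have wedge0 (A : 'M[R]_(n.+1, n + n)) :
    \sum_(i < n.+1) (-1) ^+ i * (theta (row i A) * sigma p (row' i A)) = 0.
  have E1 := cf p A; have E2 := chf p A.
  apply: (mulfI (f0 p)); rewrite mulr0 mulr_sumr.
  (* The Leibniz rule in the form d(h tau) - h d tau = dh /\ tau with tau = f sigma; both terms on
     the left vanish, and the factor [f p] is then cancelled. *)
  have : ext_deriv_coord (form_in D phi (scale_form (fun p => h p * f p) sigma)) x A -
      h p * ext_deriv_coord (form_in D phi (scale_form f sigma)) x A = 0.
    by rewrite -[LHS]/(ext_deriv D _ p A - h p * ext_deriv D _ p A) E1 E2 mulr0 subr0.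
  move=> E3; rewrite -[RHS]E3 /ext_deriv_coord mulr_sumr -sumrB; apply: eq_bigr => i _.
  have -> : (fun y => form_in D phi (scale_form (fun p => h p * f p) sigma) y (row' i A)) =
      (fun y => (h \o cinv phi) y * form_in D phi (scale_form f sigma) y (row' i A)).
    by apply/funext => y; rewrite /form_in /scale_form /= mulrA.
  have dfs : differentiable_C (fun y => form_in D phi (scale_form f sigma) y (row' i A)) x.
    exact: differentiable_CM df (ds (row' i A)).
  rewrite derive_CM //= xK -/(theta (row i A)).
  have -> : form_in D phi (scale_form f sigma) x (row' i A) = f p * sigma p (row' i A).
    by rewrite /form_in /scale_form xK /x param_tangent_at mulmx1.
  (* Here [g] stands for the derivative of the coefficient of f sigma; its two occurrences cancel,
     and only the wedge term with [theta] remains. *)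
  have distr (a b c d e g : R[i]) :
    a * (b * (c * d)) = b * (c * (a * d) + e * g) - e * (b * g) by ring.
  exact: distr.
have [B sB] := nv p.
have := zero_wedge_k0 v (k0 p) wedge0 sB.
by rewrite /theta /derive_C => /eqP; rewrite eq_complex /= => /andP[/eqP e1 /eqP e2];
  split; [rewrite /differential e1|rewrite /differential e2];
  rewrite mul0r mul1r ?sub0r ?add0r.
Qed.

Lemma closed_multiples_proportional (sigma : preform R n (n + n) M)
    (f f' : M -> R[i]) :
  compact [set: M] -> connected [set: M] ->
  is_k0_form J sigma -> nowhere_vanishing sigma ->
  smooth_fun_C D f -> (forall p, f p != 0) ->
  closed_form D (scale_form f sigma) ->
  smooth_fun_C D f' -> (forall p, f' p != 0) ->
  closed_form D (scale_form f' sigma) ->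
  forall p q, f' p / f p = f' q / f q.
Proof.
move=> cM kM k0 nv sf f0 cf sf' f'0 cf'.
pose h p := f' p / f p.
have sh : smooth_fun_C D h.
  move=> p; have oU := @cimg_open _ _ _ (chart_at D p).
  apply: (smooth_on_CM oU (sf' p)); apply: (smooth_on_CV oU _ (sf p)) => y _.
  exact: f0.
have hf : (fun p => h p * f p) = f' by apply/funext => p; rewrite /h divfK.
have CR := cauchy_riemann_of_closed k0 nv sf f0 sh cf.
rewrite hf in CR; have {}CR := CR cf'.
have sr : smooth_real D (fun p => complex.Re (h p)) by move=> p; exact: (sh p).1.
have si : smooth_real D (fun p => complex.Im (h p)) by move=> p; exact: (sh p).2.
move=> p q; rewrite -/(h p) -/(h q); apply/eqP; rewrite eq_complex.
apply/andP; split; apply/eqP.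
  exact: (cauchy_riemann_constant cM kM sr si CR p q).
exact: (cauchy_riemann_constant cM kM si (smooth_realN sr) (cauchy_riemann_rot sr CR) p q).
Qed.

End ClosedMultiples.

(** * The quotient of the group *)

(** The chain rule applied to the local inverse [H] gives a one-sided inverse of the Jacobian, and
    the matrices are square. *)
Lemma local_diffeo_tangent_unit (R : realType) (m : nat) (M N : topologicalType)
    (DM : manifold R m M) (DN : manifold R m N) (F : M -> N) (p : M) :
  local_diffeo DM DN F -> tangent DM DN F p \in unitmx.
Proof.
move=> [[cF sF] /(_ p) [A [H [oA Ap _ HF [_ sH]]]]].
have dp := mem_chart_at DM p; have dFp := mem_chart_at DN (F p).
set x := cmap (chart_at DM p) p.
have ix : cimg (chart_at DM p) x by exact: cmap_img.
have xK : cinv (chart_at DM p) x = p by exact: cmapK.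
pose f := cmap (chart_at DN (F p)) \o F \o cinv (chart_at DM p).
pose g := cmap (chart_at DM p) \o H \o cinv (chart_at DN (F p)).
have fx : f x = cmap (chart_at DN (F p)) (F p) by rewrite /f /= xK.
have df : differentiable f x.
  by apply: (smooth_on_differentiable (sF p (F p))); split=> //; rewrite xK.
have dg : differentiable g (f x).
  rewrite fx; apply: (smooth_on_differentiable (sH (F p) p)); split.
  - exact: cmap_img.
  - by rewrite cmapK //; exists p.
  - by rewrite cmapK // HF.
suff gf : \forall y \near x, g (f y) = y.
  by have [uf _] := mulmx1_unit (jacobian_cancel df dg gf); exact: uf.
have nA : nbhs p A by apply: open_nbhs_nbhs.
have nF : nbhs p (F @^-1` cdom (chart_at DN (F p))).
  by apply: (cF p I); apply: open_nbhs_nbhs; split=> //; exact: cdom_open.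
have ni : nbhs x (cimg (chart_at DM p)).
  by apply: open_nbhs_nbhs; split=> //; exact: cimg_open.
have nAF : nbhs x (cinv (chart_at DM p) @^-1` (A `&` F @^-1` cdom (chart_at DN (F p)))).
  by apply: (cinv_continuous ix); rewrite xK; exact: filterI.
by apply: filterS2 ni nAF => y iy [Ay Fy]; rewrite /g /f /= cmapK // HF // cinvK.
Qed.

Lemma within_continuous_comp (S T U : topologicalType) (A : set S)
    (f : S -> T) (g : T -> U) :
  {within A, continuous f} -> continuous g -> {within A, continuous (g \o f)}.
Proof.
move=> cf cg t; apply: (@cvg_comp _ _ _ (f : subspace A -> T) g); first exact: cf.
exact: cg.
Qed.

Section Quotient.
Variables (R : realType) (G : groupTopType) (Gamma : groupClosed G).

Lemma lproj_surj (q : lquot Gamma) : exists x, lproj Gamma x = q.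
Proof.
exists (generic_quotient.repr (q : quotient_topology _)); exact: generic_quotient.reprK.
Qed.

Lemma lproj_continuous : continuous (@lproj G Gamma).
Proof. exact: pi_continuous. Qed.

(** A path in [G] between lifts of two points projects to a connected set through both, so a clopen
    set containing one contains the other. *)
Lemma connected_lquot : simply_connected R G -> connected [set: lquot Gamma].
Proof.
move=> [path _] B [q Bq] [C oC BC] [C' cC' BC']; apply/seteqP; split=> // q' _.
have [x xq] := lproj_surj q; have [y yq'] := lproj_surj q'.
have [c [cc c0 c1]] := path x y.
have ck := within_continuous_comp cc lproj_continuous.
pose k : R -> lquot Gamma := @lproj G Gamma \o c.
have kk : connected (k @` `[0, 1]%classic)
  := connected_continuous_connected (@segment_connected R 0 1) ck.
have i0 : (k @` `[0, 1]%classic) q.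
  by exists 0; rewrite /= ?in_itv /= ?lexx ?ler01 // /k /= c0.
have i1 : (k @` `[0, 1]%classic) q'.
  by exists 1; rewrite /= ?in_itv /= ?lexx ?ler01 // /k /= c1.
have E : (k @` `[0, 1]%classic) `&` B = k @` `[0, 1]%classic.
  apply: kk; first by exists q.
  - by exists C => //; rewrite BC setTI.
  - by exists C' => //; rewrite BC' setTI.
by move: i1; rewrite -E => -[].
Qed.

(** On [G] the pullback is nonzero at some [x], since [lproj] has invertible differential and
    vectors can be lifted. The translation by [y / x] sends [x] to [y], so invariance forces the
    pullback, hence [sigma], to be nonzero over any [y]. *)
Lemma invariant_nowhere_vanishing (k m : nat) (DG : lie_group R m G)
    (DQ : manifold R m (lquot Gamma)) (sigma : preform R k m (lquot Gamma)) :
  local_diffeo DG DQ (@lproj G Gamma) -> invariant_form DG DQ sigma ->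
  nonzero_form sigma -> nowhere_vanishing sigma.
Proof.
move=> ld [_ [a [[_ inv_a] pa]]] [q [A sA]] q'.
have [x xq] := lproj_surj q; have [y yq'] := lproj_surj q'.
subst q q'; pose T := tangent DG DQ (@lproj G Gamma) x.
have ax : a x (A *m invmx T) != 0.
  by rewrite -pa /pullback -/T -mulmxA mulVmx ?mulmx1 //; exact: local_diffeo_tangent_unit.
have yE : ltrans (y / x)%g x = y by rewrite /ltrans divgK.
move: ax; rewrite -(inv_a (y / x)%g) {1}/pullback yE -pa /pullback => ay.
by eexists; exact: ay.
Qed.

End Quotient.

(** * Proportionality of (n,0)-forms *)

(** Isolates one argument of a form, so that multilinearity, given through [row] and [row'], becomes
    ordinary linearity in a vector. *)
Definition set_row (R : Type) (n m : nat) (A : 'M[R]_(n, m)) (i : 'I_n)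
    (v : 'rV[R]_m) : 'M[R]_(n, m) :=
  \matrix_(k, l) if k == i then v 0 l else A k l.

Section SetRow.
Variables (R : Type) (n m : nat).
Implicit Types (A : 'M[R]_(n, m)) (v : 'rV[R]_m).

Lemma row_set_row A i v : row i (set_row A i v) = v.
Proof. by apply/rowP => l; rewrite !mxE eqxx. Qed.

Lemma row_set_row_neq A i k v : k != i -> row k (set_row A i v) = row k A.
Proof. by move=> /negPf ki; apply/rowP => l; rewrite !mxE ki. Qed.

Lemma row'_set_row A i v v' : row' i (set_row A i v) = row' i (set_row A i v').
Proof.
by apply/matrixP => k l; rewrite !mxE [lift i k == i]eq_sym (negPf (neq_lift _ _)).
Qed.

Lemma set_row_id A i : set_row A i (row i A) = A.
Proof. by apply/matrixP => k l; rewrite !mxE; case: eqP => // ->. Qed.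

End SetRow.

Section AlternatingForms.
Variables (R : realType) (n m : nat).
Implicit Types (w : 'M[R]_(n, m) -> R[i]) (A B : 'M[R]_(n, m)) (v : 'rV[R]_m).

Lemma alternating_set_rowP w A i (b c : R) v v' : alternating_multilinear w ->
  w (set_row A i (b *: v + c *: v')) =
  b%:C * w (set_row A i v) + c%:C * w (set_row A i v').
Proof.
move=> [ml _]; apply: (ml _ _ _ i); rewrite ?row_set_row //; exact: row'_set_row.
Qed.

Lemma alternating_set_row0 w A i : alternating_multilinear w ->
  w (set_row A i 0) = 0.
Proof.
move=> aw; have := alternating_set_rowP A i 0 0 0 0 aw.
by rewrite !scale0r addr0 !mul0r addr0.
Qed.

Lemma alternating_set_row_sum w A i (l : nat) (x : 'I_l -> R) (f : 'I_l -> 'rV[R]_m) :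
  alternating_multilinear w ->
  w (set_row A i (\sum_k x k *: f k)) = \sum_k (x k)%:C * w (set_row A i (f k)).
Proof.
move=> aw; elim: (index_enum _) => [|k s IH].
  by rewrite !big_nil alternating_set_row0.
by rewrite !big_cons -{1}[\sum_(j <- s) _]scale1r alternating_set_rowP // IH mul1r.
Qed.

Lemma alternating_set_rowD w A i v v' : alternating_multilinear w ->
  w (set_row A i (v + v')) = w (set_row A i v) + w (set_row A i v').
Proof.
move=> aw; have := alternating_set_rowP A i 1 1 v v' aw.
by rewrite !scale1r !mul1r.
Qed.

(** Polarization: expand the vanishing value at (a + b, a + b) in slots [i] and [j], where a and b
    are the two rows. *)
Lemma alternating_xrow w A i j : alternating_multilinear w -> i != j ->
  w (xrow i j A) = - w A.
Proof.
move=> aw ij; have ji : j != i by rewrite eq_sym.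
pose S v v' := w (set_row (set_row A i v) j v').
have S0 v : S v v = 0.
  by apply: (aw.2 _ i j ij); rewrite row_set_row row_set_row_neq // row_set_row.
have setC v v' : set_row (set_row A i v) j v' = set_row (set_row A j v') i v.
  apply/matrixP => k l; rewrite !mxE; case: (eqVneq k j) => [->|] //.
  by rewrite (negPf ji).
have SDr v v1 v2 : S v (v1 + v2) = S v v1 + S v v2 by exact: alternating_set_rowD.
have SDl v v1 v2 : S (v1 + v2) v = S v1 v + S v2 v.
  by rewrite /S !setC alternating_set_rowD.
have := S0 (row i A + row j A); rewrite SDr !SDl !S0 add0r addr0.
have -> : S (row i A) (row j A) = w A.
  by rewrite /S !set_row_id.
have -> : S (row j A) (row i A) = w (xrow i j A).
  congr w; apply/matrixP => k l; rewrite !mxE.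
  case: (eqVneq k j) => [->|kj]; first by rewrite tpermR.
  case: (eqVneq k i) => [->|ki]; first by rewrite tpermL.
  by rewrite tpermD // eq_sym.
by move/eqP; rewrite addr_eq0 => /eqP.
Qed.

Lemma alternating_row_perm0 w A (s : 'S_n) : alternating_multilinear w ->
  w A = 0 -> w (row_perm s A) = 0.
Proof.
move=> aw; have [ts -> dts] := prod_tpermP s.
elim: ts dts A => [|t ts IH] /=; first by move=> _ A; rewrite big_nil row_perm1.
move=> /andP[dt dts] A wA; rewrite big_cons row_permM.
by rewrite -/(xrow _ _ _) alternating_xrow // IH ?oppr0.
Qed.

(** If [s] is injective it is a permutation, hence a product of transpositions, each changing only
    the sign; otherwise two rows coincide. *)
Lemma alternating_rowsub0 w A (s : 'I_n -> 'I_n) : alternating_multilinear w ->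
  w A = 0 -> w (rowsub s A) = 0.
Proof.
move=> aw wA; have [/injectiveP si|/injectivePn[i [j ij sij]]] := boolP (injectiveb s).
  rewrite -(alternating_row_perm0 (perm si) aw wA); congr w.
  by apply/matrixP => k l; rewrite !mxE permE.
apply: (aw.2 _ i j ij); apply/rowP => l; by rewrite !mxE sij.
Qed.

Lemma alternating_lin w1 w2 (a b : R[i]) : alternating_multilinear w1 ->
  alternating_multilinear w2 ->
  alternating_multilinear (fun A => w1 A * a - w2 A * b).
Proof.
move=> [m1 a1] [m2 a2]; split=> [A B C i c d rA rB rC|A i j ij rA].
  by rewrite (m1 A B C i c d) // (m2 A B C i c d) //; ring.
by rewrite (a1 A i j) // (a2 A i j) // !mul0r subrr.
Qed.

End AlternatingForms.

Section K0Forms.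
Variables (R : realType) (n : nat) (K : 'M[R]_(n + n)).
Implicit Types (w : 'M[R]_(n, n + n) -> R[i]) (A B : 'M[R]_(n, n + n)).

Lemma type_k0_set_row w A i v : type_k0 K w ->
  w (set_row A i (v *m K)) = 'i%C * w (set_row A i v).
Proof.
move=> k0; apply: (type_k0_mul (i0 := i) k0); rewrite ?row_set_row //.
exact: row'_set_row.
Qed.

Lemma mul_row_col_sum (x y : 'rV[R]_n) B :
  row_mx x y *m col_mx B (B *m K) =
  \sum_k x 0 k *: row k B + \sum_k y 0 k *: (row k B *m K).
Proof.
rewrite mul_row_col mulmx_sum_row; congr (_ + _).
by rewrite mulmx_sum_row; apply: eq_bigr => k _; rewrite -row_mul.
Qed.

Lemma type_k0_set_row_comb w A B i (x y : 'rV[R]_n) :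
  alternating_multilinear w -> type_k0 K w ->
  w (set_row A i (row_mx x y *m col_mx B (B *m K))) =
  \sum_k ((x 0 k)%:C + 'i%C * (y 0 k)%:C) * w (set_row A i (row k B)).
Proof.
move=> aw k0; rewrite mul_row_col_sum alternating_set_rowD //.
rewrite !alternating_set_row_sum // -big_split /=; apply: eq_bigr => k _.
by rewrite type_k0_set_row // mulrDl; congr (_ + _); rewrite mulrCA mulrA.
Qed.

(** Put a real linear relation among the rows b_k and b_k K into slot [i] of [w] at [B]: as K acts
    as multiplication by i and repeated rows give 0, only (x_i + i y_i) w(B) = 0 survives. So all
    coefficients vanish and the rows form a real basis. *)
Lemma k0_frame_unit w B : alternating_multilinear w -> type_k0 K w ->
  w B != 0 -> col_mx B (B *m K) \in unitmx.
Proof.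
move=> aw k0 wB; rewrite -row_free_unit; apply: inj_row_free => c cB.
have key i : (lsubmx c 0 i)%:C + 'i%C * (rsubmx c 0 i)%:C = 0.
  apply: (mulIf wB); rewrite mul0r.
  have := type_k0_set_row_comb B B i (lsubmx c) (rsubmx c) aw k0.
  rewrite hsubmxK cB alternating_set_row0 // (bigD1 i) //= set_row_id.
  rewrite big1 ?addr0 // => k ki.
  rewrite (_ : w _ = 0) ?mulr0 //; apply: (aw.2 _ k i ki).
  by rewrite row_set_row row_set_row_neq.
rewrite -[c]hsubmxK.
suff [-> ->] : lsubmx c = 0 /\ rsubmx c = 0 by rewrite row_mx0.
by split; apply/rowP => i; have /eqP := key i; rewrite eq_complex /= !mxE;
  move=> /andP[/eqP a0 /eqP b0]; lra.
Qed.

(** Each argument is expanded in the basis b_k, b_k K, and every K comes out as a factor i. What is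
    left are values of [w] on rows of [B], all zero because w(B) = 0. *)
Lemma k0_form_eq0 w B : alternating_multilinear w -> type_k0 K w ->
  col_mx B (B *m K) \in unitmx -> w B = 0 -> forall A, w A = 0.
Proof.
move=> aw k0 uB wB.
(* The first [k] rows are arbitrary and the others are already rows of [B]; the inductive step
   expands the row of index [k], the last arbitrary one. *)
have P k : (k <= n)%N -> forall A,
    (forall i : 'I_n, (k <= i)%N -> exists j, row i A = row j B) -> w A = 0.
  elim: k => [_|k IH kn] A rA.
    have [s sE] := choice (fun i => rA i (leq0n i)).
    rewrite -(alternating_rowsub0 s aw wB); congr w.
    apply/row_matrixP => i; rewrite sE; apply/rowP => l; by rewrite !mxE.
  pose i := Ordinal kn.
  rewrite -(set_row_id A i) -[row i A]mulmx1 -(mulVmx uB) mulmxA.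
  set c := row i A *m _; rewrite -[c]hsubmxK type_k0_set_row_comb //.
  apply: big1 => j _; rewrite IH ?mulr0 ?(ltnW kn) // => i' ki'.
  case: (eqVneq i' i) => [->|i'i]; first by exists j; rewrite row_set_row.
  rewrite row_set_row_neq //; apply: rA.
  by rewrite ltn_neqAle ki' andbT eq_sym.
by move=> A; apply: (P n (leqnn n)) => i; rewrite leqNgt ltn_ord.
Qed.

(** The combination w1 w2(B) - w2 w1(B) is again alternating of type (n,0) and vanishes on the frame
    [B], hence identically. *)
Lemma k0_forms_proportional w1 w2 B :
  alternating_multilinear w1 -> type_k0 K w1 ->
  alternating_multilinear w2 -> type_k0 K w2 ->
  w2 B != 0 -> forall A, w1 A = w1 B / w2 B * w2 A.
Proof.
move=> a1 k1 a2 k2 wB A; have uB := k0_frame_unit a2 k2 wB.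
have aw := alternating_lin (w2 B) (w1 B) a1 a2.
have kw : type_k0 K (fun A => w1 A * w2 B - w2 A * w1 B).
  move=> A1 A2 i r1 r2; rewrite (type_k0_mul k1 r1 r2) (type_k0_mul k2 r1 r2).
  set I := 'i%C; have I2 : I * I = -1 by rewrite -expr2 sqr_i.
  rewrite -!mulrA -mulrBr mulrA I2; ring.
have := @k0_form_eq0 _ B aw kw uB; rewrite mulrC subrr => /(_ erefl A) /eqP.
rewrite subr_eq0 => /eqP E; apply: (mulIf wB).
by rewrite E [RHS]mulrAC divfK // mulrC.
Qed.

End K0Forms.

Lemma smooth_on_C_local (R : realType) (V : normedModType R) (U : set V)
    (f : V -> R[i]) :
  (forall x, U x -> exists U', [/\ open U', U' x & smooth_on_C U' f]) ->
  smooth_on_C U f.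
Proof.
by move=> loc; split=> k; apply: Ck_on_local => x /loc [U' [oU' U'x [fr fi]]];
  exists U'.
Qed.

Lemma open_smooth_neq0 (R : realType) (V : normedModType R) (U : set V)
    (f : V -> R[i]) : open U -> smooth_on_C U f ->
  open [set x | U x /\ f x != 0].
Proof.
move=> oU [fr fi]; pose N x :=
  complex.Re (f x) * complex.Re (f x) + complex.Im (f x) * complex.Im (f x).
have N0 x : (f x != 0) = (N x != 0).
  rewrite /N -!expr2 paddr_eq0 ?sqr_ge0 // !sqrf_eq0; case: (f x) => a b.
  by rewrite eq_complex.
have cN x : U x -> {for x, continuous N}.
  move=> Ux; apply: (@continuousD _ _ _ (fun x => complex.Re (f x) * complex.Re (f x))
    (fun x => complex.Im (f x) * complex.Im (f x))).
    by apply: continuousM; exact: (fr 0%N).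
  by apply: continuousM; exact: (fi 0%N).
rewrite openE => x [Ux]; rewrite N0 => Nx.
have nU : nbhs x U by exact: open_nbhs_nbhs.
have nN : \forall y \near x, N y != 0 by exact: (cvgr_neq0 _ (cN x Ux) Nx).
by apply: filterS2 nU nN => y Uy Ny; split=> //; rewrite N0.
Qed.

(** * Smoothness of the ratio of two (n,0)-forms *)

Section K0Ratio.
Variables (R : realType) (n : nat) (M : topologicalType).
Variables (D : manifold R (n + n) M) (J : complex_structure D).

Lemma smooth_k0_ratio (w1 w2 : preform R n (n + n) M) (f : M -> R[i]) :
  is_form D w1 -> is_form D w2 -> nowhere_vanishing w2 ->
  (forall p A, w1 p A = f p * w2 p A) -> smooth_fun_C D f.
Proof.
move=> [_ s1] [_ s2] nv2 fE p; apply: smooth_on_C_local => x0 ix0.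
set phi := chart_at D p in s1 s2 ix0 *.
have [B wB] := nv2 (cinv phi x0).
(* These constant coordinate vectors represent [B] at [x0], so the coefficient of [w2] on [A] is
   nonzero there and on a neighbourhood, where [f] is a quotient of two smooth coefficients. *)
pose A := B *m invmx (param_tangent D phi x0).
pose U' := [set x | cimg phi x /\ form_in D phi w2 x A != 0].
have oU : open (cimg phi) by exact: cimg_open.
have oU' : open U' by exact: open_smooth_neq0 oU (s2 p A).
have subU : U' `<=` cimg phi by move=> x [].
exists U'; split=> //.
  split=> //; rewrite /form_in /A -mulmxA mulVmx ?mulmx1 //.
  exact: param_tangent_unit (smooth_chart_at D p) ix0.
have sub w : smooth_on_C (cimg phi) w -> smooth_on_C U' w.
  by move=> [wr wi]; split=> k; apply: Ck_on_sub subU _; [exact: wr|exact: wi].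
have s := smooth_on_CM oU' (sub _ (s1 p A)) (smooth_on_CV oU' _ (sub _ (s2 p A))).
have {s} [sr si] := s (fun x U'x => U'x.2).
have E x : U' x -> form_in D phi w1 x A * (form_in D phi w2 x A)^-1 = (f \o cinv phi) x.
  by move=> [_ nz]; rewrite /form_in fE mulfK.
by split; [apply: smooth_on_eq oU' _ sr|apply: smooth_on_eq oU' _ si] => x /E ->.
Qed.

Lemma k0_ratio (w1 w2 : preform R n (n + n) M) :
  is_k0_form J w1 -> nowhere_vanishing w1 ->
  is_k0_form J w2 -> nowhere_vanishing w2 ->
  exists f : M -> R[i], [/\ smooth_fun_C D f, forall p, f p != 0 &
    forall p A, w1 p A = f p * w2 p A].
Proof.
move=> [f1 k1] nv1 [f2 k2] nv2; have [B wB] := choice nv2.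
pose f p := w1 p (B p) / w2 p (B p).
have fE p A : w1 p A = f p * w2 p A.
  exact: k0_forms_proportional (f1.1 p) (k1 p) (f2.1 p) (k2 p) (wB p) A.
exists f; split=> //; first exact: smooth_k0_ratio fE.
move=> p; have [A] := nv1 p; rewrite fE; apply: contraNneq => ->.
by rewrite mul0r.
Qed.

End K0Ratio.

Lemma invariant_scale (R : realType) (k m : nat) (G : groupTopType)
    (Gamma : groupClosed G) (DG : lie_group R m G)
    (DQ : manifold R m (lquot Gamma)) (w w' : preform R k m (lquot Gamma))
    (c : R[i]) :
  is_form DQ w' -> invariant_form DG DQ w ->
  (forall p A, w' p A = c * w p A) -> invariant_form DG DQ w'.
Proof.
move=> fw' [_ [a [[[alt_a sa] inv_a] pa]]] E; split=> //.
exists (fun x A => c * a x A); split; last first.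
  by rewrite -pa; apply/funext => x; apply/funext => A; rewrite /pullback E.
split; last first.
  move=> g; apply/funext => x; apply/funext => A.
  by rewrite -{2}(inv_a g).
split=> [x|p A].
  have [ma aa] := alt_a x; split=> [A B C i b d rA rB rC|A i j ij rA].
    by rewrite (ma A B C i b d) //; ring.
  by rewrite (aa A i j) // mulr0.
have oU := @cimg_open _ _ _ (chart_at DG p).
have sc : smooth_on_C (cimg (chart_at DG p)) (fun=> c) by split=> l; exact: Ck_on_cst.
exact: smooth_on_CM oU sc (sa p A).
Qed.

Theorem corollary4p2 (R : realType) (n : nat)
  (G : groupTopType) (DG : lie_group R (n + n) G)
  (simply_connected_G : simply_connected R G)
  (J : complex_structure DG) (left_invariant_J : left_invariant_cs J)
  (Gamma : groupClosed G) (lattice_Gamma : uniform_lattice Gamma)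
  (* the induced smooth and complex structures on Gamma \ G *)
  (DQ : manifold R (n + n) (lquot Gamma))
  (lproj_local_diffeo : local_diffeo DG DQ (@lproj G Gamma))
  (JQ : complex_structure DQ)
  (lproj_holomorphic : holomorphic J JQ (@lproj G Gamma)) :
  (forall (sigma : preform R n (n + n) (lquot Gamma))
          (f f' : lquot Gamma -> R[i]),
     is_k0_form JQ sigma -> invariant_form DG DQ sigma ->
     nonzero_form sigma ->
     smooth_fun_C DQ f -> (forall p, f p != 0) ->
     closed_form DQ (scale_form f sigma) ->
     smooth_fun_C DQ f' -> (forall p, f' p != 0) ->
     closed_form DQ (scale_form f' sigma) ->
     exists2 c : R[i], c != 0 & forall p, f' p = c * f p)
  /\
  ((forall tau : preform R n (n + n) (lquot Gamma),
      is_k0_form JQ tau -> nowhere_vanishing tau -> closed_form DQ tau ->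
      invariant_form DG DQ tau)
   \/
   (forall tau : preform R n (n + n) (lquot Gamma),
      is_k0_form JQ tau -> nowhere_vanishing tau -> closed_form DQ tau ->
      ~ invariant_form DG DQ tau)).
Proof.
have kM : connected [set: lquot Gamma] := connected_lquot simply_connected_G.
have cM := lattice_Gamma.2.
(* Assuming that sigma vanishes nowhere lets this serve both halves: a nonzero invariant form
   satisfies it by translation, and the reference form of the dichotomy by hypothesis. *)
have uniq (sigma : preform R n (n + n) (lquot Gamma)) (f f' : lquot Gamma -> R[i]) :
    is_k0_form JQ sigma -> nowhere_vanishing sigma ->
    smooth_fun_C DQ f -> (forall p, f p != 0) ->
    closed_form DQ (scale_form f sigma) ->
    smooth_fun_C DQ f' -> (forall p, f' p != 0) ->
    closed_form DQ (scale_form f' sigma) ->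
    exists2 c : R[i], c != 0 & forall p, f' p = c * f p.
  move=> k0 nv sf f0 cf sf' f'0 cf'; pose p0 := lproj Gamma 1%g.
  exists (f' p0 / f p0); first by rewrite mulf_neq0 ?invr_neq0.
  move=> p; rewrite -(closed_multiples_proportional cM kM k0 nv sf f0 cf sf' f'0 cf' p).
  by rewrite divfK.
split.
  move=> sigma f f' k0 inv nz; apply: uniq => //.
  exact: invariant_nowhere_vanishing lproj_local_diffeo inv nz.
have [[tau0 [k0 nv0 c0 inv0]]|no_inv] :=
  pselect (exists tau : preform R n (n + n) (lquot Gamma), [/\ is_k0_form JQ tau, nowhere_vanishing tau, closed_form DQ tau &
      invariant_form DG DQ tau]); last first.
  by right=> tau k0 nv ctau inv; apply: no_inv; exists tau.
left=> tau k nv ctau; have [f [sf f0 fE]] := k0_ratio k nv k0 nv0.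
have [||||||c _ cE] := uniq tau0 (fun=> 1) f k0 nv0.
- by move=> p; split=> l; exact: Ck_on_cst.
- by move=> p; exact: oner_neq0.
- rewrite (_ : scale_form _ _ = tau0) //; apply/funext => p; apply/funext => A.
  by rewrite /scale_form mul1r.
- exact: sf.
- exact: f0.
- rewrite (_ : scale_form _ _ = tau) //; apply/funext => p; apply/funext => A.
  by rewrite /scale_form fE.
apply: (invariant_scale (c := c) k.1 inv0) => p A.
by rewrite fE cE mulr1.
Qed.
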